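(* Let $f$ be a pairwise social choice correspondence (SCC) that satisfies non-imposition, homogeneity, and neutrality. Then $f$ is (Fishburn-)strategyproof if and only if $f$ is a robust dominant set rule.
   Context: Let $\mathbb{N}=\{1,2,\dots\}$ be the set of potential voters and $A$ a finite set of $m$ alternatives. An electorate is a finite non-empty $N\subseteq\mathbb{N}$; each voter $i\in N$ has a strict total order $\succ_i$ on $A$. A preference profile is $R\in\mathcal{R}(A)^N$ for some electorate $N$, where $\mathcal{R}(A)$ is the set of strict total orders on $A$; $\mathcal{R}^*(A)$ is the set of all profiles over all electorates. The majority margin is $g_R(x,y)=|\{i\in N: x\succ_i y\}|-|\{i\in N: y\succ_i x\}|$; $x\succsim_R y$ iff $g_R(x,y)\ge 0$, with strict part $\succ_R$. For sets, $X\succ Y$ means $x\succ y$ for all $x\in X,y\in Y$. A non-empty $X\subseteq A$ is dominant in $R$ if $X\succ_R A\setminus X$. An SCC is a map $f:\mathcal{R}^*(A)\to 2^A\setminus\{\emptyset\}$. $f$ is pairwise if $f(R)=f(R')$ whenever $g_R=g_{R'}$. $f$ is non-imposing if for every $x\in A$ some profile $R$ has $f(R)=\{x\}$. $f$ is neutral if for every electorate $N$, profiles $R,R'\in\mathcal{R}(A)^N$ and permutation $\pi$ of $A$ with $x\succ_i y\iff \pi(x)\succ'_i\pi(y)$ for all $x,y,i$, we have $f(R')=\pi(f(R))$. $f$ is homogeneous if $f(kR)=f(R)$ for every profile $R$ and $k\ge1$, where $kR$ consists of $k$ copies of $R$. Fishburn's extension: for $X\neq Y$, $X\succ_i^F Y$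 iff $X\setminus Y\succ_i Y$ and $X\succ_i Y\setminus X$. $f$ is strategyproof if there is no electorate $N$, voter $i\in N$ and profiles $R,R'\in\mathcal{R}(A)^N$ with $\succ_j=\succ'_j$ for all $j\ne i$ and $f(R')\succ_i^F f(R)$. $f$ is a dominant set rule if $f(R)$ is dominant in $R$ for every profile $R$; it is robust if $f(R')\subseteq f(R)$ for all profiles $R,R'$ such that $f(R)$ is dominant in $R'$. *)

(* Defs.v *)
From HB Require Import structures.
From mathcomp Require Import all_boot all_order all_algebra all_fingroup.
From mathcomp Require Import finmap zify.
Set Implicit Arguments. Unset Strict Implicit. Unset Printing Implicit Defensive.
Import Order.TTheory GRing.Theory Num.Theory.
Local Open Scope fset_scope.

Section SCC.
Variable A : finType.

Definition strict_total_order (r : rel A) : Prop :=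
  [/\ irreflexive r, transitive r & forall x y, x != y -> r x y || r y x].

(* A preference profile: a finite non-empty electorate N of voters taken from
   {1,2,...} (positive naturals) and a strict total order for every voter in N.
   [pref R i x y] means x >_i y.  Values of [pref R i] for i outside N are junk
   and never used by the definitions below (pairwise rules only see g_R). *)
Record profile := Profile {
  elect : {fset nat};
  pref : nat -> rel A;
  elect_ne : elect != fset0;
  elect_pos : forall i, i \in elect -> (0 < i)%N;
  pref_ok : forall i, i \in elect -> strict_total_order (pref i) }.

Definition margin (R : profile) (x y : A) : int :=
  (\sum_(i <- elect R) (pref R i x y : nat))%:Z
  - (\sum_(i <- elect R) (pref R i y x : nat))%:Z.

Definition maj_weak (R : profile) (x y : A) : bool := (0 <= margin R x y)%R.
Definition maj_strict (R : profile) (x y : A) : bool :=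
  maj_weak R x y && ~~ maj_weak R y x.

Definition dominant (R : profile) (X : {set A}) : Prop :=
  X != set0 /\ forall x y, x \in X -> y \notin X -> maj_strict R x y.

(* social choice correspondences: maps profiles to subsets (non-emptiness
   is imposed as a hypothesis of the theorem) *)
Definition SCC := profile -> {set A}.

Definition is_SCC (f : SCC) : Prop := forall R, f R != set0.

Definition pairwise_scc (f : SCC) : Prop :=
  forall R R', (forall x y, margin R x y = margin R' x y) -> f R = f R'.

Definition non_imposing (f : SCC) : Prop :=
  forall x : A, exists R, f R = [set x].

Definition neutral (f : SCC) : Prop :=
  forall (R R' : profile) (pi : {perm A}),
    elect R = elect R' ->
    (forall i x y, i \in elect R -> pref R i x y = pref R' i (pi x) (pi y)) ->
    f R' = pi @: f R.

(* k copies of R (k >= 1): voter i of R gives rise to the k voters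
   i*k - c, c = 0..k-1 (all positive, pairwise distinct), each with the
   preferences of voter i.  The voter j of kR is a copy of voter
   (j + k - 1) %/ k of R. *)
Definition copies_elect (k : nat) (R : profile) : {fset nat} :=
  [fset j | j in [seq (i * k - c)%N | i <- elect R, c <- iota 0 k]].

Lemma copies_index (k i c : nat) :
  (0 < k)%N -> (0 < i)%N -> (c < k)%N -> ((i * k - c + k.-1) %/ k)%N = i.
Proof.
move=> k0 i0 ck.
have -> : (i * k - c + k.-1 = (k.-1 - c) + i * k)%N.
  have : (c <= i * k)%N by rewrite (leq_trans (ltnW ck)) // leq_pmull.
  lia.
rewrite divnDMl // divn_small ?addn0 //; lia.
Qed.

Lemma copies_mem (k : nat) (R : profile) (j : nat) :
  (0 < k)%N -> j \in copies_elect k R ->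
  [/\ (0 < j)%N & ((j + k.-1) %/ k)%N \in elect R].
Proof.
move=> k0; rewrite inE /=; case/allpairsP => [[i c]] /= [iR].
rewrite mem_iota add0n => /andP [_ ck] ->.
have i0 := elect_pos iR.
split; first by have := leq_pmull k i0; lia.
by rewrite copies_index.
Qed.

Definition copies (k : nat) (R : profile) : profile.
Proof.
refine (@Profile (copies_elect k.-1.+1 R)
          (fun j => pref R ((j + k.-1.+1.-1) %/ k.-1.+1)%N) _ _ _).
- case/fset0Pn: (elect_ne R) => i iR.
  apply/fset0Pn; exists (i * k.-1.+1 - 0)%N.
  rewrite inE; apply/allpairsP; exists (i, 0%N) => /=.
  by rewrite iR.

- by move=> j /copies_mem [].
- by move=> j /copies_mem [// | _ /pref_ok].
Defined.

Definition homogeneous (f : SCC) : Prop :=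
  forall (R : profile) (k : nat), (1 <= k)%N -> f (copies k R) = f R.

Definition fishburn (r : rel A) (X Y : {set A}) : Prop :=
  X != Y /\
  (forall x y, x \in X :\: Y -> y \in Y -> r x y) /\
  (forall x y, x \in X -> y \in Y :\: X -> r x y).

Definition strategyproof (f : SCC) : Prop :=
  ~ exists (R R' : profile) (i : nat),
      [/\ elect R = elect R', i \in elect R,
          (forall j x y, j \in elect R -> j != i -> pref R j x y = pref R' j x y)
        & fishburn (pref R i) (f R') (f R)].

Definition dominant_set_rule (f : SCC) : Prop := forall R, dominant R (f R).

Definition robust (f : SCC) : Prop :=
  forall R R', dominant R' (f R) -> f R' \subset f R.

End SCC.

(* Main.v *)
Require Import Defs.
From HB Require Import structures.
From mathcomp Require Import all_boot all_order all_algebra all_fingroup.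
From mathcomp Require Import finmap zify.
Set Implicit Arguments. Unset Strict Implicit. Unset Printing Implicit Defensive.
Import Order.TTheory GRing.Theory Num.Theory.
Local Open Scope ring_scope.

(** McGarvey's construction and homogeneity turn f into a map F on integral
    skew-symmetric matrices g (the profile chosen for g has margins 2g), and a
    voter swapping two adjacent blocks of alternatives gives strategyproofness
    constraints on how F changes when one entry of g changes by one.

    Let P be the smallest dominating set of g.  The core is that P is contained
    in F g.  In a counterexample with #|P| minimal, exactly one element l of P is
    missing from F g.  Lowering a against b (with b <> l) while P stays the
    smallest dominating set either keeps l or moves it in a prescribed way, and
    the position is contradictory as soon as some x <> l of P is weakly beaten
    by no other element than l, since a chosen alternative that beats all other
    chosen ones is the only chosen one and a Condorcet winner.  Such a position
    can always be forced: peel elements off P one by one, moving each below the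
    rest, until the first peeled one is weakly beaten by l alone.

    Given the core, if x is chosen, y is not and x does not beat y, then some t
    of P can be lowered to a tie with x without any change of F g, which forces
    y into P.  Robustness follows because F g is unaffected by erasing all
    margins inside it and by raising it over the other alternatives. *)

Ltac ilia :=
  repeat match goal with
  | H : is_true (Order.le _ _) |- _ => revert H
  | H : is_true (Order.lt _ _) |- _ => revert H
  | H : is_true (leq _ _) |- _ => revert H
  | H : is_true (~~ (Order.le _ _)) |- _ => revert H
  | H : is_true (~~ (Order.lt _ _)) |- _ => revert H
  end; clear; lia.

(** * Integral skew-symmetric matrices and their smallest dominating sets *)

Section Matrices.
Variable A : finType.
Implicit Types (g : A -> A -> int) (a b x y z : A) (D P Q : {set A}).

Definition skew g := forall x y, g y x = - g x y.

Definition lower a b g : A -> A -> int := fun x y =>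
  if (x == a) && (y == b) then g x y - 1
  else if (x == b) && (y == a) then g x y + 1 else g x y.

Definition dominating g D :=
  D != set0 /\ forall x y, x \in D -> y \notin D -> 0 < g x y.

Definition top g P := dominating g P /\ forall D, dominating g D -> P \subset D.

Lemma skew_diag g x : skew g -> g x x = 0.
Proof. by move=> /(_ x x); ilia. Qed.

Lemma skew_lower a b g : a != b -> skew g -> skew (lower a b g).
Proof.
move=> /eqP ab sg x y; rewrite /lower (sg x y).
by case: (x =P a) => ?; case: (y =P b) => ?; case: (x =P b) => ?; case: (y =P a) => ? /=;
  first [ilia | congruence].
Qed.

Lemma lower_lt a b g : lower a b g a b = g a b - 1.
Proof. by rewrite /lower !eqxx. Qed.

Lemma lower_gt a b g : a != b -> lower a b g b a = g b a + 1.
Proof. by move=> ab; rewrite /lower !eqxx (eq_sym b) (negbTE ab). Qed.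

Lemma lower_id a b g x y :
  ~~ ((x == a) && (y == b)) -> ~~ ((x == b) && (y == a)) ->
  lower a b g x y = g x y.
Proof. by rewrite /lower => /negbTE -> /negbTE ->. Qed.

Lemma lower_row a b g y : y != a -> y != b -> lower a b g a y = g a y.
Proof.
by move=> ya yb; rewrite lower_id // ?(negbTE yb) ?(negbTE ya) andbF.
Qed.

Lemma lower_le a b g x y : (x, y) != (b, a) -> lower a b g x y <= g x y.
Proof. by rewrite xpair_eqE /lower => /negbTE ->; case: ifP; ilia. Qed.

Lemma lower_ge a b g x y : (x, y) != (a, b) -> g x y <= lower a b g x y.
Proof. by rewrite xpair_eqE /lower => /negbTE ->; case: ifP; ilia. Qed.

(** Otherwise an element of [D] outside [D'] and one of [D'] outside [D] would beat each other. *)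
Lemma dominating_nested g D D' : skew g -> dominating g D -> dominating g D' ->
  (D \subset D') || (D' \subset D).
Proof.
move=> sg [_ d] [_ d']; apply/orP.
have [|/subsetPn[x xD xD']] := boolP (D \subset D'); first by left.
right; apply/subsetP => y yD'; apply/negPn/negP => yD.
by have := d _ _ xD yD; have := d' _ _ yD' xD'; rewrite (sg x y); ilia.
Qed.

Lemma top_exists g (a0 : A) : skew g -> exists P, top g P.
Proof.
move=> sg.
pose p (D : {set A}) := (D != set0) && [forall x in D, forall y in ~: D, 0 < g x y].
have pP D : reflect (dominating g D) (p D).
  apply: (iffP andP) => -[D0 d]; split=> //.
    move=> x y xD yD; move/forall_inP/(_ x xD)/forall_inP: d; apply.
    by rewrite inE.
  apply/forall_inP => x xD; apply/forall_inP => y; rewrite inE; exact: d.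
have p0 : p setT.
  apply/pP; split; first by apply/set0Pn; exists a0.
  by move=> x y; rewrite !inE.
case: (arg_minnP (fun D : {set A} => #|D|) p0) => P /pP dP minP.
exists P; split=> // D dD.
case/orP: (dominating_nested sg dP dD) => // DP.
by move/pP/minP: dD => le; rewrite -(eqP (_ : D == P)) // eqEcard DP.
Qed.

(** The only entry that grows is [g b a], and after a unit step it is still at most 0, so no new
    strict win arises. *)
Lemma dominating_lower a b g D : skew g -> a != b -> 0 < g a b ->
  dominating (lower a b g) D -> dominating g D.
Proof.
move=> sg ab gab [D0 d]; split=> // x y xD yD.
have := d x y xD yD; case: (eqVneq (x, y) (b, a)) => [[-> ->]|/lower_le]; last first.
  by move=> /(_ g); ilia.
by rewrite lower_gt // (sg a b); ilia.
Qed.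

Definition pos (i : int) : nat := if i is Posz n then n else 0%N.

Lemma pos0 i : i <= 0 -> pos i = 0%N.
Proof. by case: i => i //=; lia. Qed.

Lemma pos_le i j : i <= j -> (pos i <= pos j)%N.
Proof. by case: i => i; case: j => j //=; ilia. Qed.

Lemma pos_lt i j : i < j -> 0 < j -> (pos i < pos j)%N.
Proof. by case: i => i; case: j => j //=; ilia. Qed.

Lemma sum_ltn_in (I : finType) (E : {pred I}) (f h : I -> nat) i :
  (forall j, j \in E -> (f j <= h j)%N) -> i \in E -> (f i < h i)%N ->
  (\sum_(j in E) f j < \sum_(j in E) h j)%N.
Proof.
move=> le iE lt; rewrite (bigD1 i) //= [X in (_ < X)%N](bigD1 i) //= -addSn leq_add //.
by apply: leq_sum => j /andP[/le].
Qed.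

End Matrices.

(** * The abstract game of moving the missing element *)

(* S g l abstracts "the smallest dominating set of g is P and the chosen part of
   P is P :\ l"; the game shows that no such g exists. *)
Section Game.
Variables (A : finType) (P : {set A}) (S : (A -> A -> int) -> A -> Prop).
Implicit Types (g : A -> A -> int) (a b x y z : A) (D Q : {set A}).
Hypothesis S_skew : forall g l, S g l -> skew g.
Hypothesis S_top : forall g l, S g l -> top g P.
Hypothesis S_mem : forall g l, S g l -> l \in P.
Hypothesis S_move : forall g l a b, S g l -> a \in P -> b \in P -> a != b ->
  b != l -> top (lower a b g) P ->
  S (lower a b g) l \/ S (lower a b g) (if a == l then b else a).
Hypothesis S_win : forall g l x, S g l -> x \in P -> x != l ->
  ~ (forall v, v \in P -> v != x -> 0 <= g v x -> v = l).

(* P is split into Q and the peeled elements P :\: Q, of which y1 was peeled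
   first and w last; w leads back to the rest through z alone. *)
Record frame Q z y1 w g : Prop := Frame {
  fr_sub : Q \subset P;
  fr_mem : z \in Q;
  fr_above : forall b y, b \in Q -> b != z -> y \in P -> y \notin Q -> 0 < g b y;
  fr_first : forall y, y \in P -> y \notin Q -> y != y1 -> 0 < g y1 y;
  fr_last : forall y, y \in P -> y \notin Q -> 0 <= g y w;
  fr_mem1 : forall y, y \in P -> y \notin Q -> y1 \in P :\: Q;
  fr_memw : forall y, y \in P -> y \notin Q -> w \in P :\: Q;
  fr_w : forall y, y \in P -> y \notin Q -> 0 <= g w z;
  fr_full : Q = P -> forall b, b \in Q -> b != z -> 0 <= g b z }.

Definition outer g := forall x y, x \in P -> y \notin P -> 0 < g x y.

Lemma outer_lower a b g : a \in P -> b \in P -> outer g -> outer (lower a b g).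
Proof.
move=> aP bP o x y xP yP; rewrite lower_id ?o //.
  by apply: contraNN yP => /andP[_ /eqP->].
by apply: contraNN yP => /andP[_ /eqP->].
Qed.

Lemma S_outer g l : S g l -> outer g.
Proof. by move=> /S_top[[_]]. Qed.

(** A dominating set contains whatever weakly beats one of its elements. From any start this closure
    reaches [c], then [z], then [w] if something has been peeled, and from there all of [P]. *)
Lemma frame_top Q z y1 w g c : skew g -> outer g -> frame Q z y1 w g ->
  c \in Q -> c != z -> 0 <= g z c ->
  (forall b, b \in Q -> b != z -> 0 <= g c b) -> top g P.
Proof.
move=> sg o [QP zQ ab _ la _ mw wz full] cQ cz zc cb.
have cP := subsetP QP _ cQ; have zP := subsetP QP _ zQ.
split.
  by split=> //; apply/set0Pn; exists c.
move=> D [/set0Pn[d dD] dom].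
have cl x y : x \in D -> 0 <= g y x -> y \in D.
  move=> xD yx; apply/negPn/negP => /(dom _ _ xD); rewrite (sg y x); ilia.
have clQ b : b \in D -> b \in Q -> b != z -> c \in D.
  by move=> bD bQ bz; apply: cl bD _; apply: cb.
have clY y : y \in D -> y \in P -> y \notin Q -> c \in D.
  by move=> yD yP yQ; apply: cl yD _; have := ab c y cQ cz yP yQ; ilia.
have [e eD eP] : exists2 e, e \in D & e \in P.
  have [dP|/(o c _ cP)] := boolP (d \in P); first by exists d.
  by exists c => //; apply: cl dD _; ilia.
have [QPe|nQP] := eqVneq Q P; last first.
  have [y yP yQ] : exists2 y, y \in P & y \notin Q.
    by apply/subsetPn; apply: contraNN nQP => ?; rewrite eqEsubset QP.
  have /setDP[wP wQ] := mw y yP yQ.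
  have zwD : z \in D -> w \in D by move=> zD; apply: cl zD (wz y yP yQ).
  have cD : c \in D.
    have [eQ|eQ] := boolP (e \in Q); last exact: clY eD eP eQ.
    have [ez|ez] := eqVneq e z; last exact: clQ eD eQ ez.
    by rewrite ez in eD; apply: clY (zwD eD) wP wQ.
  have zD : z \in D by apply: cl cD zc.
  have wD := zwD zD.
  apply/subsetP => x xP; have [xQ|xQ] := boolP (x \in Q); last first.
    exact: cl wD (la x xP xQ).
  have [->//|xz] := eqVneq x z.
  by apply: cl wD _; have := ab x w xQ xz wP wQ; ilia.
have cD : c \in D.
  rewrite -QPe in eP; have [ez|ez] := eqVneq e z; last exact: clQ eD eP ez.
  by rewrite ez in eD; apply: cl eD (full QPe c cQ cz).
have zD : z \in D by apply: cl cD zc.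
apply/subsetP => x; rewrite -QPe => xQ; have [->//|xz] := eqVneq x z.
exact: cl zD (full QPe x xQ xz).
Qed.

(** The position after [w] has been peeled off. Apart from ties with [Q], [z] is weakly beaten by
    [w] alone, so raising [z] over the rest of [Q] wins if [w] stays missing, and otherwise brings
    the missing element into [Q]. *)
Record attached Q z y1 w g l : Prop := Attached {
  at_frame : frame Q z y1 w g;
  at_tie : forall b b', b \in Q -> b' \in Q -> b != z -> b' != z -> 0 <= g b b';
  at_reach : forall b, b \in Q -> b != z -> 0 <= g z b;
  at_above : forall y, y \in P -> y \notin Q -> y != w -> 0 < g z y;
  at_mark : (l \in Q) || (l == w);
  at_size : (1 < #|Q|)%N;
  at_proper : Q != P }.


(** No inequality of a frame has [z] on its winning side or an element of [Q :\ z] on its losing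
    side, and those of [Q] over [z] are required only when [Q = P]. So these steps never lower a
    required entry. *)
Lemma frame_lower Q z y1 w g a b : frame Q z y1 w g ->
  [\/ a = z, b \in Q /\ b != z | [/\ b = z, a \in Q & Q != P]] ->
  frame Q z y1 w (lower a b g).
Proof.
move=> [QP zQ ab fi la m1 mw wz full] h.
have keep x y (i : int) : (x, y) != (a, b) -> i <= g x y -> i <= lower a b g x y.
  by move=> ne le; apply: le_trans le (lower_ge _ ne).
have keeps x y (i : int) : (x, y) != (a, b) -> i < g x y -> i < lower a b g x y.
  by move=> ne le; apply: lt_le_trans le (lower_ge _ ne).
have Qn y x : y \notin Q -> x \in Q -> y == x = false.
  by move=> yQ xQ; apply: contraNF yQ => /eqP->.
split=> //.
- move=> x y xQ xz yP yQ; apply: keeps (ab x y xQ xz yP yQ); rewrite xpair_eqE.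
  by case: h => [->|[bQ bz]|[-> aQ _]]; rewrite ?(negbTE xz) // (Qn y) // andbF.
- move=> y yP yQ yy; apply: keeps (fi y yP yQ yy); rewrite xpair_eqE.
  have /setDP[_ y1Q] := m1 y yP yQ.
  by case: h => [->|[bQ bz]|[-> aQ _]]; [rewrite (Qn y1) | rewrite (Qn y b) // andbF | rewrite (Qn y z) // andbF].
- move=> y yP yQ; apply: keep (la y yP yQ); rewrite xpair_eqE.
  have /setDP[_ wQ] := mw y yP yQ.
  by case: h => [->|[bQ bz]|[-> aQ _]]; [rewrite (Qn y) | rewrite (Qn w b) // andbF | rewrite (Qn w z) // andbF].
- move=> y yP yQ; apply: keep (wz y yP yQ); rewrite xpair_eqE.
  have /setDP[_ wQ] := mw y yP yQ.
  by case: h => [->|[bQ bz]|[-> aQ _]]; [rewrite (Qn w) | rewrite (eq_sym z) (negbTE bz) andbF | rewrite (Qn w)].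
- move=> QPe x xQ xz; apply: keep (full QPe x xQ xz); rewrite xpair_eqE.
  by case: h => [->|[bQ bz]|[_ _]];
    [rewrite (negbTE xz) | rewrite (eq_sym z) (negbTE bz) andbF | rewrite QPe eqxx].
Qed.

(** Peels [z] off: it is strictly below everything except possibly [c], so it can serve as the new
    [w] while [c] takes over its role. If [z] is the first to be peeled, it is the new [y1] too. *)
Lemma attached_next Q z y1 w g c l : skew g -> frame Q z y1 w g ->
  c \in Q -> c != z -> 0 <= g z c ->
  (forall b b', b \in Q :\ z :\ c -> b' \in Q :\ z :\ c -> 0 <= g b b') ->
  (forall b, b \in Q -> b != z -> 0 <= g c b) ->
  (forall b, b \in Q -> b != z -> b != c -> 0 < g b z) ->
  (forall y, y \in P -> y \notin Q -> 0 < g y z) ->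
  l \in Q -> (1 < #|Q :\ z|)%N ->
  attached (Q :\ z) c (if Q == P then z else y1) z g l.
Proof.
move=> sg fr cQ cz zc tie cb low high lQ sz.
have [QP zQ ab fi la m1 mw wz full] := fr.
have sb := subsetP QP; have zP := sb _ zQ.
have inY y : y \in P -> y \notin Q :\ z -> y = z \/ y \notin Q.
  by move=> yP; rewrite !inE negb_and negbK => /orP[/eqP|]; [left|right].
have zQ' : Q :\ z != P by apply: contraTneq zP => <-; rewrite !inE eqxx.
have y1Q : Q != P -> y1 \in P :\: Q.
  rewrite eqEsubset QP /= => /subsetPn[x xP xQ]; exact: m1 xP xQ.
split=> //.
- split.
  + by apply/subsetP => x /setD1P[_ /sb].
  + by rewrite !inE cz.
  + move=> b y bQz bc yP; have /setD1P[bz bQ] := bQz.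
    by case/(inY _ yP) => [->|yQ]; [apply: low | apply: ab].
  + move=> y yP; case: (Q =P P) => [QPe|/eqP QPn].
      by case/(inY _ yP) => [->|]; rewrite ?eqxx // QPe yP.
    case/(inY _ yP) => [->|yQ] yy1; last exact: fi.
    by have /setDP[? ?] := y1Q QPn; apply: high.
  + move=> y yP; case/(inY _ yP) => [->|yQ]; first by rewrite (skew_diag _ sg).
    exact: ltW (high y yP yQ).
  + move=> y yP yQ; case: (Q =P P) => [_|/eqP QPn]; first by rewrite !inE eqxx zP.
    by have /setDP[y1P y1Q'] := y1Q QPn; rewrite !inE y1P (negbTE y1Q') andbF.
  + by move=> y _ _; rewrite !inE eqxx zP.
  + by [].
  + by move/eqP; rewrite (negbTE zQ').
- move=> b b' /setD1P[bz bQ] /setD1P[bz' bQ'] bc bc'.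
  by apply: tie; rewrite !inE ?bc ?bc' ?bz ?bz'.
- by move=> b /setD1P[bz bQ] bc; apply: cb.
- move=> y yP; case/(inY _ yP) => [->|yQ _]; first by rewrite eqxx.
  exact: ab.
- by rewrite !inE lQ andbT; case: eqP.
Qed.

(* z is on its way out of Q, already below all of Q except c, which is to take
   over the role of z. *)
Record peeled Q z y1 w c g l : Prop := Peeled {
  pe_frame : frame Q z y1 w g;
  pe_mem : c \in Q;
  pe_neq : c != z;
  pe_link : 0 <= g z c;
  pe_tie : forall b b', b \in Q :\ z :\ c -> b' \in Q :\ z :\ c -> 0 <= g b b';
  pe_reach : forall b, b \in Q -> b != z -> 0 <= g c b;
  pe_low : forall b, b \in Q :\ z :\ c -> 0 < g b z;
  pe_mark : l \in Q :\ c }.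

(** If [z] is missing, [c] is raised until [z] alone weakly beats it, a winning position. Otherwise
    [z] is lowered below the peeled elements and then peeled off. The offsets 1 make the sum drop
    even when the step starts from a tie. *)
Lemma no_peeled Q z0 y1 w c :
  (forall z y1 w g l, S g l -> ~ attached (Q :\ z0) z y1 w g l) ->
  forall n g l, (\sum_(b in P) (pos (1 - g c b) + pos (1 + g z0 b)) < n)%N ->
  S g l -> ~ peeled Q z0 y1 w c g l.
Proof.
set z := z0; move=> IH; elim=> // n IHn g l lt Sg [fr cQ cz zc tie cb low /setD1P[lc lQ]].
have sg := S_skew Sg; have o := S_outer Sg.
have sb := subsetP (fr_sub fr); have zQ := fr_mem fr.
have [cP zP] := (sb _ cQ, sb _ zQ).
have [lz|lz] := eqVneq l z.
  rewrite {}lz in Sg lc lQ.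
  have [/exists_inP[b bQ cb0]|/exists_inPn win] := boolP [exists b in Q :\ z :\ c, g c b <= 0].
    have /setD1P[bc /setD1P[bz bQ']] := bQ.
    have bP := sb _ bQ'.
    have fr' : frame Q z y1 w (lower b c g) by apply: frame_lower fr _; constructor 2.
    have zc' : 0 <= lower b c g z c by rewrite lower_id // ?(eq_sym z) ?(negbTE bz) ?(negbTE cz).
    have cb' x : x \in Q -> x != z -> 0 <= lower b c g c x.
      move=> xQ xz; apply: le_trans (cb x xQ xz) _; apply: lower_ge.
      by rewrite xpair_eqE (eq_sym c) (negbTE bc).
    have st l' : l' \in Q :\ c -> peeled Q z y1 w c (lower b c g) l'.
      move=> l'Q; split=> // x; last first.
        move=> xQ; apply: lt_le_trans (low x xQ) _; apply: lower_ge.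
        by rewrite xpair_eqE (eq_sym z) (negbTE cz) andbF.
      move=> x' xQ x'Q; have := tie _ _ xQ x'Q; rewrite lower_id //.
        by move: x'Q; rewrite !inE => /andP[/negbTE->]; rewrite andbF.
      by move: xQ; rewrite !inE => /andP[/negbTE->].
    have lt' : (\sum_(x in P) (pos (1 - lower b c g c x) + pos (1 + lower b c g z x)) < n)%N.
      rewrite -ltnS (leq_trans _ lt) // ltnS; apply: (@sum_ltn_in _ _ _ _ b) => //.
        move=> x _; apply: leq_add; apply: pos_le.
          have := @lower_ge _ b c g c x; rewrite xpair_eqE (eq_sym c) (negbTE bc) => /(_ isT); ilia.
        by rewrite lower_id // ?(eq_sym z) ?(negbTE bz) ?(negbTE cz).
      rewrite lower_gt // (lower_id _ (x:=z)) ?(eq_sym z) ?(negbTE bz) ?(negbTE cz) //.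
      by rewrite ltn_add2r pos_lt //; ilia.
    case: (S_move Sg bP cP bc cz (frame_top (skew_lower bc sg) (outer_lower bP cP o) fr' cQ cz zc' cb')).
      by move=> Sg'; apply: IHn lt' Sg' (st _ _); rewrite !inE eq_sym cz.
    by rewrite (negbTE bz) => Sg'; apply: IHn lt' Sg' (st _ _); rewrite !inE bc.
  apply: (S_win Sg cP cz) => v vP vc vc0; apply/eqP; apply: contraT => vz.
  have [vQ|vQ] := boolP (v \in Q).
    by have := win v; rewrite !inE vc vz vQ (sg v c) => /(_ isT); ilia.
  by have := fr_above fr cQ cz vP vQ; rewrite (sg v c); ilia.
have [/exists_inP[y yY zy]|/exists_inPn high] := boolP [exists y in P :\: Q, 0 <= g z y].
  have /setDP[yP yQ] := yY.
  have neQ x : x \in Q -> x == y = false by move=> xQ; apply: contraNF yQ => /eqP<-.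
  have zy' : z != y by rewrite neQ.
  have fr' : frame Q z y1 w (lower z y g) by apply: frame_lower fr _; constructor 1.
  have zc' : 0 <= lower z y g z c by rewrite lower_id // neQ ?andbF.
  have cb' x : x \in Q -> x != z -> 0 <= lower z y g c x.
    by move=> xQ xz; rewrite lower_id ?cb // ?neQ ?andbF.
  have st l' : l' \in Q :\ c -> peeled Q z y1 w c (lower z y g) l'.
    move=> l'Q; split=> // x; last first.
      move=> xQ; apply: lt_le_trans (low x xQ) _; apply: lower_ge.
      by rewrite xpair_eqE; move: xQ; rewrite !inE => /and3P[_ /negbTE->].
    move=> x' xQ x'Q; have := tie _ _ xQ x'Q; rewrite lower_id //.
      by move: x'Q; rewrite !inE => /and3P[_ _ /neQ->]; rewrite andbF.
    by move: xQ; rewrite !inE => /and3P[_ _ /neQ->].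
  have lt' : (\sum_(x in P) (pos (1 - lower z y g c x) + pos (1 + lower z y g z x)) < n)%N.
    rewrite -ltnS (leq_trans _ lt) // ltnS.
    have cid x : lower z y g c x = g c x by rewrite lower_id ?(negbTE cz) ?(neQ _ cQ).
    apply: (@sum_ltn_in _ _ _ _ y) => //.
      move=> x _; rewrite cid leq_add2l; apply: pos_le.
      by have := @lower_le _ z y g z x; rewrite xpair_eqE (negbTE zy') => /(_ isT); ilia.
    by rewrite cid lower_lt ltn_add2l pos_lt //; ilia.
  have yl : y != l by rewrite eq_sym neQ.
  case: (S_move Sg zP yP zy' yl (frame_top (skew_lower zy' sg) (outer_lower zP yP o) fr' cQ cz zc' cb')).
    by move=> Sg'; apply: IHn lt' Sg' (st _ _); rewrite !inE lc.
  by rewrite eq_sym (negbTE lz) => Sg'; apply: IHn lt' Sg' (st _ _); rewrite !inE eq_sym cz.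
have {}high y : y \in P -> y \notin Q -> 0 < g y z.
  by move=> yP yQ; have := high y; rewrite !inE yP yQ (sg z y) => /(_ isT); ilia.
have lowz b : b \in Q -> b != z -> b != c -> 0 < g b z.
  by move=> bQ bz bc; apply: low; rewrite !inE bc bz.
have sz : (1 < #|Q :\ z|)%N.
  rewrite (cardsD1 c) (cardsD1 l) !inE cz lc lz cQ lQ /=; ilia.
exact: IH Sg (attached_next sg fr cQ cz zc tie cb lowz high lQ sz).
Qed.

(* z is on its way out of Q; the tie or victory of z over c keeps P connected. *)
Record peeling Q z y1 w c g l : Prop := Peeling {
  pg_frame : frame Q z y1 w g;
  pg_mem : c \in Q;
  pg_neq : c != z;
  pg_link : 0 <= g z c;
  pg_tie : forall b b', b \in Q -> b' \in Q -> b != z -> b' != z -> 0 <= g b b';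
  pg_mark : l \in Q :\ c }.

(** [z] is lowered against [Q], sparing the link [c] and the missing [l]. If [l] is not yet above
    [z], it is then lowered against the peeled elements and finally against [c]. The link keeps [P]
    the smallest dominating set. *)
Lemma no_peeling Q z0 y1 w c :
  (forall z y1 w g l, S g l -> ~ attached (Q :\ z0) z y1 w g l) ->
  forall n g l, (\sum_(b in P) pos (1 + g z0 b) < n)%N ->
  S g l -> ~ peeling Q z0 y1 w c g l.
Proof.
set z := z0; move=> IH; elim=> // n IHn g l lt Sg [fr cQ cz zc tie /setD1P[lc lQ]].
have sg := S_skew Sg; have o := S_outer Sg.
have sb := subsetP (fr_sub fr); have zQ := fr_mem fr.
have [cP zP] := (sb _ cQ, sb _ zQ).
have ties b x y : x != z -> y != z -> lower z b g x y = g x y.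
  by move=> xz yz; rewrite lower_id ?(negbTE xz) ?(negbTE yz) ?andbF.
have tie' b x y : x \in Q -> y \in Q -> x != z -> y != z -> 0 <= lower z b g x y.
  by move=> xQ yQ xz yz; rewrite ties ?tie.
have frz b : frame Q z y1 w (lower z b g) by apply: frame_lower fr _; constructor 1.
have move b : b \in P -> b != z -> b != l -> top (lower z b g) P ->
    S (lower z b g) l \/ S (lower z b g) (if l == z then b else z).
  by move=> bP bz bl tp; rewrite (eq_sym l); apply: S_move; rewrite // eq_sym.
have step b : b \in P -> b != z -> b != l -> 0 <= g z b ->
    0 <= lower z b g z c -> (l = z -> b \in Q :\ c) -> False.
  move=> bP bz bl zb zc' lzb; have zb' : z != b by rewrite eq_sym.
  have st l' : l' \in Q :\ c -> peeling Q z y1 w c (lower z b g) l'.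
    by move=> l'Q; split=> //; apply: tie'.
  have lt' : (\sum_(x in P) pos (1 + lower z b g z x) < n)%N.
    rewrite -ltnS (leq_trans _ lt) // ltnS; apply: (@sum_ltn_in _ _ _ _ b) => //.
      move=> x _; apply: pos_le.
      by have := @lower_le _ z b g z x; rewrite xpair_eqE (negbTE zb') => /(_ isT); ilia.
    by rewrite lower_lt pos_lt //; ilia.
  case: (move b bP bz bl (frame_top (skew_lower zb' sg) (outer_lower zP bP o) (frz b) cQ cz zc'
           (fun x xQ xz => tie' b c x cQ xQ cz xz))).
    by move=> Sg'; apply: IHn lt' Sg' (st _ _); rewrite !inE lc.
  case: eqP => [lz|lz] Sg'; first exact: IHn lt' Sg' (st _ (lzb lz)).
  by apply: IHn lt' Sg' (st _ _); rewrite !inE zQ eq_sym cz.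
have [/exists_inP[b bQ /andP[bl zb]]|/exists_inPn low0] :=
    boolP [exists b in Q :\ z :\ c, (b != l) && (0 <= g z b)].
  have /setD1P[bc /setD1P[bz bQ']] := bQ.
  apply: (step b) => //; first exact: sb.
    by rewrite lower_row // eq_sym.
  by rewrite !inE bc bQ'.
have {}low0 b : b \in Q -> b != z -> b != c -> b != l -> 0 < g b z.
  move=> bQ bz bc bl; have := low0 b; rewrite !inE bz bc bQ bl (sg z b) => /(_ isT); ilia.
(* In the first case [z] is strictly below all of [Q] except itself and [c], as [peeled] asks. *)
have [lowl|zl] := boolP ((l == z) || (0 < g l z)).
  apply: (@no_peeled Q z y1 w c IH _ g l (ltnSn _) Sg); split=> //.
  - by move=> b b' /setD1P[_ /setD1P[bz bQ]] /setD1P[_ /setD1P[bz' bQ']]; apply: tie.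
  - by move=> b bQ bz; apply: tie.
  - move=> b /setD1P[bc /setD1P[bz bQ]]; have [bl|bl] := eqVneq b l; last exact: low0.
    by move: lowl; rewrite -bl (negbTE bz).
  - by rewrite !inE lc.
move: zl; rewrite negb_or => /andP[lz zl].
have {}zl : 0 <= g z l by rewrite (sg l z); ilia.
have [/exists_inP[y /setDP[yP yQ] zy]|/exists_inPn high] := boolP [exists y in P :\: Q, 0 <= g z y].
  have neQ x : x \in Q -> x == y = false by move=> xQ; apply: contraNF yQ => /eqP<-.
  have nQe x : x \in Q -> y == x = false by move=> xQ; rewrite eq_sym neQ.
  apply: (step y) => //; rewrite ?nQe //; last by move/eqP; rewrite (negbTE lz).
  by rewrite lower_id // neQ ?andbF.
have {}high y : y \in P -> y \notin Q -> 0 < g y z.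
  by move=> yP yQ; have := high y; rewrite !inE yP yQ (sg z y) => /(_ isT); ilia.
have [zc1|zc1] := boolP (0 <= lower z c g z c).
  by apply: (step c) => //; rewrite 1?eq_sym //; move/eqP; rewrite (negbTE lz).
(* This step cuts the link from [z] to [c]. Since [z] still weakly beats [l], the latter becomes the
   new link and [z] leaves [Q]. *)
have zc' : z != c by rewrite eq_sym.
have sg' := skew_lower zc' sg.
have zl' : 0 <= lower z c g z l.
  by rewrite lower_row.
have sz : (1 < #|Q :\ z|)%N.
  rewrite (cardsD1 c) (cardsD1 l) !inE cz lc lz cQ lQ /=; ilia.
have nx l' : l' \in Q -> S (lower z c g) l' -> False.
  move=> l'Q Sg'; apply: (IH _ _ _ _ _ Sg' (attached_next sg' (frz c) lQ lz zl' _ _ _ _ l'Q sz)).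
  - by move=> b b' /setD1P[_ /setD1P[bz bQ]] /setD1P[_ /setD1P[bz' bQ']]; apply: tie'.
  - by move=> b bQ bz; apply: tie'.
  - move=> b bQ bz bl; have [->|bc] := eqVneq b c; first by rewrite (sg' z c); ilia.
    by rewrite lower_id ?(negbTE bz) ?(negbTE bc) ?low0.
  - move=> y yP yQ; apply: lt_le_trans (high y yP yQ) _; apply: lower_ge.
    by rewrite xpair_eqE; apply: contraNN yQ => /andP[/eqP->].
have cl : c != l by rewrite eq_sym.
case: (move c cP cz cl (frame_top sg' (outer_lower zP cP o) (frz c) lQ lz zl'
         (fun x xQ xz => tie' c l x lQ xQ lz xz))); first exact: nx.
by rewrite (negbTE lz); apply: nx.
Qed.

(** [Q] consists of [z] and the missing [c], and [z] is lowered against [y1]. If [c] stays missing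
    until [y1] beats [z], only [c] weakly beats [y1]; if [z] becomes missing, only [z] can weakly
    beat [c]. Both positions are winning. *)
Lemma no_pair Q z y1 w c : Q != P -> c \in Q -> c != z -> Q :\ z :\ c = set0 ->
  forall n g, (pos (1 + g z y1) < n)%N -> 0 <= g z c -> S g c -> ~ frame Q z y1 w g.
Proof.
move=> QP cQ cz Q0; elim=> // n IHn g lt zc Sg fr.
have sg := S_skew Sg; have o := S_outer Sg.
have sb := subsetP (fr_sub fr); have zQ := fr_mem fr.
have [cP zP] := (sb _ cQ, sb _ zQ).
have Qzc v : v \in Q -> v != c -> v = z.
  move=> vQ vc; apply/eqP; apply: contraT => vz.
  by have := in_set0 v; rewrite -Q0 !inE vc vz vQ.
have /setDP[y1P y1Q] : y1 \in P :\: Q.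
  move: QP; rewrite eqEsubset (fr_sub fr) /= => /subsetPn[x xP xQ].
  exact: (fr_mem1 fr xP xQ).
have neQ x : x \in Q -> x == y1 = false by move=> xQ; apply: contraNF y1Q => /eqP<-.
have nQe x : x \in Q -> y1 == x = false by move=> xQ; rewrite eq_sym neQ.
have [zy1|y1z] := boolP (0 <= g z y1); last first.
  apply: (S_win Sg y1P); rewrite ?nQe // => v vP vy1 vy.
  have [vQ|vQ] := boolP (v \in Q).
    apply/eqP; apply: contraT => /(Qzc _ vQ) vz; rewrite vz in vy; ilia.
  by have := fr_first fr vP vQ vy1; rewrite (sg v y1); ilia.
have zy : z != y1 by rewrite neQ.
have y1c : y1 != c by rewrite nQe.
have fr' : frame Q z y1 w (lower z y1 g) by apply: frame_lower fr _; constructor 1.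
have zc' : 0 <= lower z y1 g z c by rewrite lower_row // eq_sym.
have sg' := skew_lower zy sg.
have cb b : b \in Q -> b != z -> 0 <= lower z y1 g c b.
  move=> bQ bz; have [->|/(Qzc _ bQ) e] := eqVneq b c; last by rewrite e eqxx in bz.
  by rewrite (skew_diag _ sg').
case: (S_move Sg zP y1P zy y1c (frame_top sg' (outer_lower zP y1P o) fr' cQ cz zc' cb)).
  have lt' : (pos (1 + lower z y1 g z y1) < n)%N.
    by rewrite -ltnS (leq_trans _ lt) // ltnS lower_lt pos_lt //; ilia.
  by move=> Sg'; apply: (IHn _ lt' zc' Sg' fr').
rewrite eq_sym in cz; rewrite (negbTE cz) => Sg'; apply: (S_win Sg' cP); rewrite 1?eq_sym //.
move=> v vP vc vc0; have [vQ|vQ] := boolP (v \in Q); first exact: Qzc.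
rewrite eq_sym in cz; have := fr_above fr' cQ cz vP vQ.
by rewrite (sg' v c); ilia.
Qed.

(** Outer induction on the size of [Q], inner on how far [z] is from beating [Q]. If the missing
    element lies in [Q], [z] is peeled off with a different element as link, or [no_pair] applies;
    if it is [w], [z] is raised against [Q]. *)
Lemma no_attached m Q : (#|Q| <= m)%N ->
  forall z y1 w g l, S g l -> ~ attached Q z y1 w g l.
Proof.
elim: m Q => [|m IHm] Q sQ z y1 w.
  by move=> g l _ at_; have := at_size at_; ilia.
suff main n g l : (\sum_(b in P) pos (1 - g z b) < n)%N -> S g l -> ~ attached Q z y1 w g l.
  by move=> g l; apply: main (ltnSn _).
elim: n g l => // n IHn g l lt Sg [fr tie zb zy mark sz QP].
have sg := S_skew Sg; have o := S_outer Sg.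
have sb := subsetP (fr_sub fr); have zQ := fr_mem fr.
have zP := sb _ zQ.
have IH z' y1' w' g' l' : S g' l' -> ~ attached (Q :\ z) z' y1' w' g' l'.
  by apply: IHm; rewrite (cardsD1 z) zQ in sQ.
have [c] : exists c, c \in Q :\ z.
  by apply/set0Pn; rewrite -card_gt0; rewrite (cardsD1 z) zQ in sz.
case/setD1P=> cz cQ.
have [lQ|lQ] := boolP (l \in Q).
  have pg x : x \in Q -> x != z -> x != l -> False.
    move=> xQ xz xl; apply: (no_peeling IH (ltnSn _) Sg); split; [exact: fr | exact: xQ | by [] | | | ].
    - exact: zb.
    - exact: tie.
    - by rewrite !inE eq_sym xl.
  have [lc|lc] := eqVneq l c; last by apply: (pg c); rewrite // eq_sym.
  have [Q0|[x]] := set_0Vmem (Q :\ z :\ c); last first.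
    by rewrite !inE -lc => /and3P[xl xz xQ]; apply: (pg x).
  by rewrite lc in Sg; apply: (no_pair QP cQ cz Q0 (ltnSn _) (zb _ cQ cz) Sg fr).
move: mark; rewrite (negbTE lQ) /= => /eqP lw.
have [/exists_inP[b /setD1P[bz bQ] zb0]|/exists_inPn win] := boolP [exists b in Q :\ z, g z b <= 0].
  have bP := sb _ bQ.
  have fr' : frame Q z y1 w (lower b z g) by apply: frame_lower fr _; constructor 3.
  have up x : 0 <= g z x -> 0 <= lower b z g z x.
    by move=> h; apply: le_trans h (lower_ge _ _); rewrite xpair_eqE (eq_sym z) (negbTE bz).
  have tie' x y : x \in Q -> y \in Q -> x != z -> y != z -> 0 <= lower b z g x y.
    by move=> xQ yQ xz yz; rewrite lower_id ?tie // ?(negbTE xz) ?(negbTE yz) ?andbF.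
  have zl : z != l by apply: contraNneq lQ => <-.
  have lt' : (\sum_(x in P) pos (1 - lower b z g z x) < n)%N.
    rewrite -ltnS (leq_trans _ lt) // ltnS; apply: (@sum_ltn_in _ _ _ _ b) => //.
      move=> x _; apply: pos_le.
      by have := @lower_ge _ b z g z x; rewrite xpair_eqE (eq_sym z) (negbTE bz) => /(_ isT); ilia.
    by rewrite lower_gt // pos_lt //; ilia.
  have st l' : (l' \in Q) || (l' == w) -> attached Q z y1 w (lower b z g) l'.
    split=> //; first by move=> x xQ xz; apply/up/zb.
    move=> y yP yQ yw; apply: lt_le_trans (zy y yP yQ yw) (lower_ge _ _).
    by rewrite xpair_eqE (eq_sym z) (negbTE bz).
  case: (S_move Sg bP zP bz zl (frame_top (skew_lower bz sg) (outer_lower bP zP o) fr' cQ cz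
     (up _ (zb _ cQ cz)) (fun x xQ xz => tie' c x cQ xQ cz xz))).
    by move=> Sg'; apply: IHn lt' Sg' (st _ _); rewrite lw eqxx orbT.
  have -> : b == l = false by apply: contraNF lQ => /eqP<-.
  by move=> Sg'; apply: IHn lt' Sg' (st _ _); rewrite bQ.
apply: (S_win Sg zP); first by apply: contraNneq lQ => <-.
move=> v vP vz vz0; have [vQ|vQ] := boolP (v \in Q).
  by have := win v; rewrite !inE vz vQ (sg v z) => /(_ isT); ilia.
apply/eqP; apply: contraT; rewrite lw => vw.
by have := zy v vP vQ vw; rewrite (sg v z); ilia.
Qed.

Lemma top_lower g a b : skew g -> a \in P -> b \in P -> a != b -> 0 < g a b -> top g P ->
  top (lower a b g) P.
Proof.
move=> sg aP bP ab gab [dP minP]; have [P0 o] := dP.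
split; last by move=> D /(dominating_lower sg ab gab)/minP.
by split=> //; apply: outer_lower.
Qed.

(** Wins over elements other than [l] are first lowered to ties. Then [P :\ l] is tied and weakly
    beats [l], while minimality of [P] yields some [c] that [l] weakly beats, so [l] can be the
    first element peeled. *)
Lemma no_failure : (1 < #|P|)%N -> forall g l, ~ S g l.
Proof.
move=> sP; suff main n g l : (\sum_(a in P) \sum_(b in P) pos (g a b) < n)%N -> ~ S g l.
  by move=> g l; apply: main (ltnSn _).
elim: n g l => // n IHn g l lt Sg.
have sg := S_skew Sg; have o := S_outer Sg; have lP := S_mem Sg.
have [|none] := boolP [exists a in P, exists b in P, (b != l) && (0 < g a b)].
  case/exists_inP=> a aP /exists_inP[b bP /andP[bl gab]].
  have ab : a != b by apply: contraTneq gab => ->; rewrite (skew_diag _ sg).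
  have gle x y : x \in P -> y \in P -> (pos (lower a b g x y) <= pos (g x y))%N.
    move=> xP yP; case: (eqVneq (x, y) (b, a)) => [[-> ->]|/lower_le]; last by move=> /(_ g)/pos_le.
    by rewrite lower_gt // (sg a b) pos0 //; ilia.
  have lt' : (\sum_(x in P) \sum_(y in P) pos (lower a b g x y) < n)%N.
    rewrite -ltnS (leq_trans _ lt) // ltnS; apply: (@sum_ltn_in _ _ _ _ a) => //.
      by move=> x xP; apply: leq_sum => y; apply: gle.
    apply: (@sum_ltn_in _ _ _ _ b) => //; first by move=> y; apply: gle.
    by rewrite lower_lt pos_lt //; ilia.
  by case: (S_move Sg aP bP ab bl (top_lower sg aP bP ab gab (S_top Sg))); apply: IHn.
have star a b : a \in P -> b \in P -> b != l -> g a b <= 0.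
  move=> aP bP bl; rewrite leNgt; apply: contraNN none => gab.
  by apply/exists_inP; exists a => //; apply/exists_inP; exists b; rewrite // bl.
have [c cP /andP[cl lc]] : exists2 c, c \in P & (c != l) && (0 <= g l c).
  apply/exists_inP; apply: contraT => /exists_inPn no.
  have dom : dominating g (P :\ l).
    split; first by rewrite -card_gt0; rewrite (cardsD1 l) lP in sP.
    move=> x y /setD1P[xl xP]; rewrite !inE negb_and negbK => /orP[/eqP->|]; last exact: o.
    by have := no x xP; rewrite xl (sg x l) /=; ilia.
  by have [_ /(_ _ dom)/subsetP/(_ _ lP)] := S_top Sg; rewrite !inE eqxx.
have IH z y1 w g' l' : S g' l' -> ~ attached (P :\ l) z y1 w g' l' by apply: (no_attached (leqnn _)).
(* With [Q = P] nothing has been peeled yet, and the last two [l] are mere placeholders for [y1] and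
   [w]. *)
apply: (@no_peeling P l l l c IH _ g l (ltnSn _) Sg); split=> //.
- split=> //.
  + by move=> b y _ _ yP; rewrite yP.
  + by move=> y yP; rewrite yP.
  + by move=> y yP; rewrite yP.
  + by move=> y yP; rewrite yP.
  + by move=> y yP; rewrite yP.
  + by move=> y yP; rewrite yP.
  + by move=> _ b bP bl; have := star l b lP bP bl; rewrite (sg b l); ilia.
- by move=> b b' bP b'P bl b'l; have := star b' b b'P bP bl; rewrite (sg b b'); ilia.
- by rewrite !inE eq_sym cl.
Qed.

End Game.

(** * Walks between matrices in unit steps, and orders given by keys *)

Section Walks.
Variable A : finType.
Implicit Types (g h : A -> A -> int) (a b x y z : A) (B C D P : {set A}).

(** For [N = 1] and disjoint blocks this is, up to a factor 2, the effect on margins of one voter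
    moving [C] from directly below [B] to directly above it. *)
Definition raise C B (N : nat) g : A -> A -> int := fun x y =>
  g x y + (((x \in C) && (y \in B))%:Z - ((x \in B) && (y \in C))%:Z) * N%:Z.

Lemma skew_raise C B N g : skew g -> skew (raise C B N g).
Proof. by move=> sg x y; rewrite /raise (sg x y) ![(y \in _) && _]andbC; ilia. Qed.

Lemma lower_raise a b g : a != b -> lower a b g =2 raise [set b] [set a] 1 g.
Proof.
move=> /eqP ab x y; rewrite /lower /raise !inE.
by case: (x =P a) => ?; case: (y =P b) => ?; case: (x =P b) => ?; case: (y =P a) => ? /=;
  first [ilia | congruence].
Qed.

Definition between (i j k : int) : bool := (i <= j <= k) || (k <= j <= i).

(** By skewness an entry that is too small is opposite to one that is too large, so lowering steps
    suffice to reach [g1], never overshooting. *)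
Lemma walk (I : (A -> A -> int) -> Prop) g0 g1 :
  (forall g g', g =2 g' -> I g -> I g') -> skew g0 -> skew g1 -> I g0 ->
  (forall g a b, skew g -> I g -> (forall x y, between (g0 x y) (g x y) (g1 x y)) ->
     a != b -> g1 a b < g a b -> I (lower a b g)) -> I g1.
Proof.
move=> ext s0 s1 I0 step.
suff main n g : (\sum_x \sum_y pos (g x y - g1 x y) < n)%N -> skew g -> I g ->
    (forall x y, between (g0 x y) (g x y) (g1 x y)) -> I g1.
  by apply: main (ltnSn _) s0 I0 _ => x y; rewrite /between; ilia.
elim: n g => // n IHn g lt sg Ig btw.
have [/existsP[a /existsP[b gab]]|no] := boolP [exists a, exists b, g1 a b < g a b]; last first.
  have le a b : g a b <= g1 a b.
    by rewrite leNgt; apply: contraNN no => h; apply/existsP; exists a; apply/existsP; exists b.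
  by apply: ext Ig => x y; have := le x y; have := le y x; rewrite (sg x y) (s1 x y); ilia.
have ab : a != b by apply: contraTneq gab => ->; rewrite !skew_diag.
apply: (IHn (lower a b g)); [| exact: skew_lower | exact: step |]; last first.
  move=> x y; have [[-> ->]|nab] := eqVneq (x, y) (a, b).
    by have := btw a b; rewrite lower_lt /between; ilia.
  have [[-> ->]|nba] := eqVneq (x, y) (b, a).
    by have := btw a b; rewrite lower_gt // /between (sg a b) (s0 a b) (s1 a b); ilia.
  by rewrite lower_id // -xpair_eqE.
have le x y : (pos (lower a b g x y - g1 x y) <= pos (g x y - g1 x y))%N.
  case: (eqVneq (x, y) (b, a)) => [[-> ->]|/lower_le h]; last first.
    by apply: pos_le; have := h g; ilia.
  by rewrite lower_gt // (sg a b) (s1 a b) pos0 //; ilia.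
rewrite -ltnS (leq_trans _ lt) // ltnS.
apply: (@sum_ltn_in _ _ _ _ a) => //; first by move=> x _; apply: leq_sum.
apply: (@sum_ltn_in _ _ _ _ b) => //.
by rewrite lower_lt pos_lt //; ilia.
Qed.

Lemma bounded g : exists2 N : nat, (0 < N)%N & forall x y, g x y <= N%:Z.
Proof.
exists (\sum_x \sum_y pos (g x y)).+1 => // x y.
have : (pos (g x y) <= \sum_x \sum_y pos (g x y))%N.
  by rewrite (bigD1 x) //= (bigD1 y) //=; ilia.
by case: (g x y) => k /=; ilia.
Qed.

Definition key_order (key : A -> nat) : rel A := fun x y =>
  (key x < key y)%N || (key x == key y) && (enum_rank x < enum_rank y)%N.

Lemma key_order_total key : strict_total_order (key_order key).
Proof.
rewrite /key_order; split.
- by move=> x; ilia.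
- by move=> y x z; ilia.
- move=> x y; have [//|xy] := eqVneq x y => _.
  have : enum_rank x <> enum_rank y :> nat by move/val_inj/enum_rank_inj/eqP; rewrite (negbTE xy).
  ilia.
Qed.

End Walks.

(** * Strategyproof rules on matrices: single changes, Condorcet winners and the core *)

Section Rule.
Variables (A : finType) (F : (A -> A -> int) -> {set A}).
Implicit Types (g h : A -> A -> int) (a b c x y z : A) (B C D P X Y : {set A}).
Hypothesis F_ext : forall g g', g =2 g' -> F g = F g'.
Hypothesis F_ne : forall g, skew g -> F g != set0.
Hypothesis F_hom : forall g N, skew g -> (0 < N)%N -> F (fun x y => g x y * N%:Z) = F g.
Hypothesis F_neutral : forall g g' (pi : {perm A}), skew g -> skew g' ->
  (forall x y, g x y = g' (pi x) (pi y)) -> F g' = pi @: F g.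
Hypothesis F_imp : forall x, exists2 g, skew g & F g = [set x].
Hypothesis F_sp : forall g r r', skew g -> strict_total_order r -> strict_total_order r' ->
  ~ fishburn r (F (fun x y => g x y + (r' x y : nat)%:Z - (r x y : nat)%:Z)) (F g).

(* The order in which Fishburn's extension prefers Y to X: Y :\: X, then X :&: Y,
   then X :\: Y. *)
Definition level X Y x : nat :=
  if x \in X then (if x \in Y then 2 else 3) else (if x \in Y then 1 else 0).

(** If both alternatives failed, some order would place [B] directly above [C] and rank [Y :\: X],
    [X :&: Y], [X :\: Y] in this sequence; its owner would manipulate by swapping the blocks. *)
Lemma raise_changes g B C : let X := F g in let Y := F (raise C B 1 g) in
  skew g -> [disjoint B & C] -> X != Y ->
  (exists b c, [/\ b \in B, c \in C & (0 < level X Y c < level X Y b)%N]) \/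
  [/\ exists2 d, d \in Y :\: X & d \in B :|: C, exists2 d, d \in X :\: Y & d \in B :|: C
    & ~~ (X :&: Y \subset B :|: C)].
Proof.
move=> X Y sg dBC XY.
have [/existsP[b /existsP[c /and3P[bB cC l]]]|no1] := boolP [exists b, exists c,
   [&& b \in B, c \in C & (0 < level X Y c < level X Y b)%N]].
  by left; exists b, c.
have {}no1 b c : b \in B -> c \in C -> (0 < level X Y c)%N -> (level X Y b <= level X Y c)%N.
  move=> bB cC l; rewrite leqNgt; apply: contraNN no1 => l'.
  by apply/existsP; exists b; apply/existsP; exists c; rewrite bB cC l l'.
pose U := B :|: C.
have [|no2] := boolP [&& [exists d in Y :\: X, d \in U], [exists d in X :\: Y, d \in U]
   & ~~ (X :&: Y \subset U)].
  by case/and3P=> /exists_inP d1 /exists_inP d2 K; right.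
exfalso.
(* Small keys are preferred. The upper block gets keys 10 to 13 and the lower one 14 to 17, sorted
   by level. Outside the blocks, [Y :\: X] comes before them and [X :\: Y] after; [X :&: Y] comes
   before, or after if a block meets [Y :\: X]. *)
pose kU := if [exists d in Y :\: X, d \in U] then 20%N else 1%N.
pose base x := nth 30 [:: 30; 0; kU; 21]%N (level X Y x).
pose key x := if x \in B then (10 + level X Y x)%N else
              if x \in C then (14 + level X Y x)%N else base x.
pose key' x := if x \in C then (10 + level X Y x)%N else
               if x \in B then (14 + level X Y x)%N else base x.
apply: (F_sp sg (key_order_total key) (key_order_total key')).
have lev3 x : (level X Y x <= 3)%N by rewrite /level; do 2 case: ifP.
have kUP : kU = 20%N \/ kU = 1%N by rewrite /kU; case: ifP; [left|right].
have baseP x : (base x < 10)%N || (20 <= base x)%N.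
  have := lev3 x; rewrite /base; case: kUP => ->;
    case: (level X Y x) => [|[|[|[|n]]]] //= _; ilia.
rewrite (@F_ext _ (raise C B 1 g)); last first.
  move=> x y; have := baseP x; have := baseP y; have := lev3 x; have := lev3 y.
  rewrite /raise /key_order /key /key'.
  have [xB|xB] := boolP (x \in B); have [yB|yB] := boolP (y \in B);
    rewrite ?(disjointFr dBC xB) ?(disjointFr dBC yB) /=; try ilia.
  - by case: (y \in C); ilia.
  - by case: (x \in C); ilia.
  - by case: (x \in C); case: (y \in C); ilia.
have lt x y : (key x < key y)%N -> key_order key x y by rewrite /key_order => ->.
have D1U x : x \in Y :\: X -> x \in U -> kU = 20%N.
  move=> xD xU; rewrite /kU; case: ifP => // /negbT/exists_inPn/(_ x xD).
  by rewrite xU.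
have D2U x y : x \in X :\: Y -> x \in U -> y \in X :&: Y -> y \notin U -> kU = 1%N.
  move=> xD xU yK yU; rewrite /kU; case: ifP => // h; case/negP: no2.
  rewrite h /=; apply/andP; split; first by apply/exists_inP; exists x.
  by apply/subsetPn; exists y.
have UE x : (x \in U) = (x \in B) || (x \in C) by rewrite inE.
split; first by rewrite eq_sym.
have main x y : (0 < level X Y x < level X Y y)%N -> (key x < key y)%N.
{ move=> l; have := no1 y x; have := lev3 x; have := lev3 y.
  have lx1 : level X Y x = 1%N -> x \in Y :\: X.
    by rewrite /level inE; do 2 case: ifP.
  have l2 z : level X Y z = 2%N -> z \in X :&: Y.
    by rewrite /level inE; do 2 case: ifP.
  have ly3 : level X Y y = 3%N -> y \in X :\: Y.
    by rewrite /level inE; do 2 case: ifP.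
  move: (D1U x) (D2U y x); rewrite !UE /key /base.
  move: lx1 (l2 x) (l2 y) ly3 l; move: (level X Y x) (level X Y y) => i j.
  case: i => [|[|[|i]]]; case: j => [|[|[|[|j]]]] //= h1 h2 h3 h4 _;
    do 2 case: (_ \in B) => /=; do 2 case: (_ \in C) => //=; try ilia.
  all: move=> k1 k2 _ _ _;
    by [rewrite (k1 (h1 erefl) isT) | rewrite (k2 (h4 erefl) isT (h2 erefl) isT) | case: kUP => ->]. }
split=> x y.
  rewrite inE => /andP[xX xY] yX; apply/lt/main; move: xX xY yX.
  by rewrite /level -/X -/Y => /negbTE-> -> ->; case: ifP.
rewrite inE => xY /andP[yY yX]; apply/lt/main; move: xY yY yX.
by rewrite /level -/X -/Y => -> /negbTE-> ->; case: ifP.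
Qed.

Lemma lower_changes g a b : let X := F g in let Y := F (lower a b g) in
  skew g -> a != b -> X != Y ->
  [\/ a \in X :&: Y /\ b \in Y :\: X, a \in X :\: Y /\ b \in Y
    | [/\ a \in Y :\: X, b \in X :\: Y & X :&: Y != set0]].
Proof.
move=> X Y sg ab XY; have YE : F (raise [set b] [set a] 1 g) = Y by apply/esym/F_ext/lower_raise.
have dab : [disjoint [set a] & [set b]] by rewrite disjoints1 inE.
have := raise_changes sg dab; rewrite /= YE -/X => /(_ XY).
case=> [[a' [b' [/set1P-> /set1P->]]]|[[d1]]].
  rewrite /level !inE.
  by case: (a \in X); case: (a \in Y); case: (b \in X); case: (b \in Y) => //= _;
    first [by constructor 1|by constructor 2].
move=> d1D /set2P d1ab [d2 d2D /set2P d2ab] K.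
have K0 : X :&: Y != set0 by apply: contraNneq K => ->; apply: sub0set.
case: d1ab d2ab d1D d2D => -> [->|->] d1D d2D; first 1 last.
- by constructor 3.
- by constructor 2; split=> //; case/setDP: d1D.
- by case/setDP: d1D d2D => _ /negbTE aX; rewrite inE aX andbF.
- by case/setDP: d1D d2D => _ /negbTE aX; rewrite inE aX andbF.
Qed.

(** Elements of [B] are not chosen, so their level is at most 1 and no positive level lies below it;
    the other alternative of [raise_changes] fails because [C] contains the whole choice. *)
Lemma raise_free g B C N : skew g -> [disjoint B & C] -> F g \subset C -> [disjoint B & F g] ->
  F (raise C B N g) = F g.
Proof.
move=> sg dBC FC BF; elim: N => [|N IHN].
  by apply: F_ext => x y; rewrite /raise mulr0 addr0.
have sg' := skew_raise C B N sg.
rewrite -IHN (@F_ext _ (raise C B 1 (raise C B N g))); last by move=> x y; rewrite /raise; ilia.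
apply/eqP; rewrite eq_sym; apply: contraT => ne.
case: (raise_changes sg' dBC ne) => [[b [c [bB cC]]]|[_ [d dX dBC'] /negP[]]].
  rewrite /level IHN (disjointFr BF bB); do 3 case: ifP => //.
by rewrite IHN; apply: subset_trans (subsetIl _ _) (subset_trans FC (subsetUr _ _)).
Qed.

Lemma lower_outsider g x a b : skew g -> a != b -> a != x -> F g = [set x] ->
  F (lower a b g) = [set x].
Proof.
move=> sg ab ax Fg; apply/eqP; rewrite -Fg eq_sym; apply: contraT => ne.
case: (lower_changes sg ab ne); rewrite Fg.
- by case; rewrite !inE (negbTE ax).
- by case; rewrite !inE (negbTE ax) andbF.
- case=> _; rewrite !inE => /andP[bF /eqP bx] /set0Pn[y].
  by rewrite !inE => /andP[/eqP->]; rewrite -bx (negbTE bF).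
Qed.

(** Start from a matrix that chooses [x] alone and scale [g] beyond its entries: the walk between
    them never lowers [x], and lowering others preserves the choice. *)
Lemma condorcet_chosen g x : skew g -> (forall z, z != x -> 0 < g x z) -> F g = [set x].
Proof.
move=> sg cw; have [g0 s0 F0] := F_imp x.
have [N N0 gN] := bounded g0.
have sgN : skew (fun y z => g y z * N%:Z) by move=> y z /=; rewrite (sg y z); ilia.
rewrite -(F_hom sg N0); apply: (walk (I := fun h => F h = [set x]) _ s0 sgN F0) => [h h' /F_ext <-//|].
move=> h a b sh Fh btw ab lt; apply: lower_outsider => //.
apply: contraTneq lt => ->; have [-> |bx] := eqVneq b x.
  by rewrite !skew_diag.
have := btw x b; have := cw b bx; have := gN x b; rewrite /between; move: N0; clear; nia.
Qed.

(* Otherwise z could be made a clone of y without losing {y} as the choice. *)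
Lemma chosen_condorcet g y z : skew g -> F g = [set y] -> z != y -> 0 < g y z.
Proof.
move=> sg Fg zy; rewrite ltNge; apply/negP => gyz.
pose s x := if x == z then y else x.
pose g1 u v := g (s u) (s v).
have s1 : skew g1 by move=> u v; apply: sg.
have F1 : F g1 = [set y].
  apply: (walk (I := fun h => F h = [set y]) _ sg s1 Fg) => [h h' /F_ext <-//|].
  move=> h a b sh Fh btw ab lt; apply: lower_outsider => //.
  apply: contraTneq lt => ->; have := btw y b; rewrite /g1 /s eq_sym (negbTE zy) /between.
  have [->|bz] := eqVneq b z; last by clear; ilia.
  (* The entry of [y] against [z] only rises, to 0, and the rest of row [y] is fixed, so [y] is
     never lowered. *)
  by rewrite (skew_diag _ sg); ilia.
have inv u v : g1 u v = g1 (tperm y z u) (tperm y z v).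
  have st x : s (tperm y z x) = s x.
    rewrite /s; case: tpermP => [->|->|_ /eqP/negbTE->] //.
      by rewrite eqxx eq_sym (negbTE zy).
    by rewrite eqxx eq_sym (negbTE zy).
  by rewrite /g1 !st.
have := F_neutral s1 s1 inv; rewrite F1 imset_set1 tpermL => /set1_inj yz.
by rewrite yz eqxx in zy.
Qed.

(** Pushing all unchosen alternatives far below the chosen ones keeps the choice and makes [x] a
    Condorcet winner. *)
Lemma internal_condorcet g x : skew g -> x \in F g ->
  (forall v, v \in F g -> v != x -> 0 < g x v) -> F g = [set x].
Proof.
move=> sg xF cw; have [N N0 gN] := bounded (fun x y => - g x y).
have BF : [disjoint ~: F g & F g] by rewrite disjoints_subset subxx.
rewrite -(raise_free N.+1 sg BF (subxx _) BF); apply: condorcet_chosen.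
  exact: skew_raise.
move=> z zx; rewrite /raise !inE xF /=; have := gN x z.
have [zF|zF] := boolP (z \in F g); last by clear; ilia.
by have := cw z zF zx; clear; ilia.
Qed.

(* Pushing a missing w far down yields a smaller dominating set, which is chosen;
   two different missing elements would give a dominating set inside P. *)
Lemma one_missing P g y w :
  (forall P' g', (#|P'| < #|P|)%N -> skew g' -> top g' P' -> P' \subset F g') ->
  skew g -> top g P -> y \in P -> y \notin F g -> w \in P -> w \notin F g -> y = w.
Proof.
move=> IH sg [[P0 dP] minP]; wlog suff sub : / forall y w, y \in P -> y \notin F g ->
    w \in P -> w \notin F g -> y != w -> exists T : {set A},
    [/\ T != set0, T \subset F g & forall x v, x \in T -> v \notin T -> v != w -> 0 < g x v].
  move=> yP yF wP wF; apply/eqP; apply: contraT => yw.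
  have [T [T0 TF dT]] := sub y w yP yF wP wF yw.
  have wy : w != y by rewrite eq_sym.
  have [T' [T'0 T'F dT']] := sub w y wP wF yP yF wy.
  have nF (U : {set A}) x t : U \subset F g -> x \notin F g -> t \in U -> t != x.
    by move=> UF xF /(subsetP UF) tF; apply: contraNneq xF => <-.
  (* [U] beats all but perhaps [v], and [v] too because [V] contains [U], misses [v] and beats all
     but perhaps [u]. So [U] dominates and must contain [P], including the unchosen [u]. *)
  have fin (U V : {set A}) u v : U != set0 -> U \subset F g -> V \subset F g -> U \subset V ->
      u \in P -> u \notin F g -> v \notin F g -> v != u ->
      (forall x z, x \in U -> z \notin U -> z != v -> 0 < g x z) ->
      (forall x z, x \in V -> z \notin V -> z != u -> 0 < g x z) -> False.
    move=> U0 UF VF UV uP uF vF vu dU dV.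
    have dom : dominating g U.
      split=> // x z xU zU; have [->|zv] := eqVneq z v; last exact: dU.
      apply: dV (subsetP UV _ xU) _ vu.
      by apply: contraNN vF => /(subsetP VF).
    by move/minP/subset_trans/(_ UF)/subsetP/(_ u uP): dom; rewrite (negbTE uF).
  have [TT'|/subsetPn[t tT tT']] := boolP (T \subset T').
    by case: (fin T T' y w).
  have [T'T|/subsetPn[t' t'T' t'T]] := boolP (T' \subset T).
    by case: (fin T' T w y).
  have := dT t t' tT t'T (nF _ _ _ T'F wF t'T').
  have := dT' t' t t'T' tT' (nF _ _ _ TF yF tT).
  by rewrite (sg t t'); ilia.
move=> {}y {}w yP yF wP wF yw.
have [N N0 gN] := bounded (fun x y => - g x y).
pose h := raise (~: [set w]) [set w] N.+1 g.
have sh : skew h by apply: skew_raise.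
have Fh : F h = F g.
  apply: raise_free => //.
  - by rewrite disjoints_subset setCK.
  - by rewrite subsetC sub1set inE.
  - by rewrite disjoints1.
have hw x v : x != w -> v != w -> h x v = g x v.
  by move=> xw vw; rewrite /h /raise !inE (negbTE xw) (negbTE vw) /=; ilia.
have hlow x : x != w -> 0 < h x w.
  by move=> xw; rewrite /h /raise !inE eqxx xw (negbTE xw) /=; have := gN x w; ilia.
have [T tT] : exists T, top h T by apply: (top_exists y).
have [[T0 dT] minT] := tT.
have domP : dominating h (P :\ w).
  split; first by apply/set0Pn; exists y; rewrite !inE yw.
  move=> x v /setD1P[xw xP]; rewrite !inE negb_and negbK.
  have [->|vw] := eqVneq v w; first by move=> _; apply: hlow.
  by rewrite hw //=; apply: dP.
have sT : (#|T| < #|P|)%N.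
  by rewrite (cardsD1 w P) wP add1n ltnS subset_leq_card ?minT.
have TF : T \subset F g by rewrite -Fh; apply: IH.
exists T; split=> // x v xT vT vw; rewrite -hw ?dT //.
by apply: contraNneq wF => <-; apply: (subsetP TF).
Qed.

(** Strong induction on the size of [P]: by [one_missing] a failure is a position of the game, which
    [no_failure] excludes. *)
Lemma top_chosen P g : skew g -> top g P -> P \subset F g.
Proof.
elim: {P}_.+1 {-2}P g (ltnSn #|P|) => // n IHn P g; rewrite ltnS => leP sg tP.
have {}IHn P' g' : (#|P'| < #|P|)%N -> skew g' -> top g' P' -> P' \subset F g'.
  by move=> lt; apply: IHn; apply: leq_trans lt leP.
apply/subsetP => p pP; apply: contraT => pF; exfalso.
have [P1|sP] := leqP #|P| 1.
  have PE : P = [set p] by apply/esym/eqP; rewrite eqEcard sub1set pP cards1.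
  rewrite PE in tP; have [[_ dP] _] := tP.
  rewrite (@condorcet_chosen g p) ?inE ?eqxx // in pF.
  by move=> z zp; apply: dP; rewrite !inE ?eqxx.
pose S h l := [/\ skew h, top h P, l \in P, l \notin F h & forall q, q \in P -> q != l -> q \in F h].
have mkS h l : skew h -> top h P -> l \in P -> l \notin F h -> S h l.
  move=> sh tp lP lF; split=> // q qP; apply: contraNT => qF; apply/eqP.
  exact: (one_missing IHn sh tp).
apply: (@no_failure A P S _ _ _ _ _ sP g p (mkS g p sg tP pP pF)).
- by move=> h l [].
- by move=> h l [].
- by move=> h l [].
- move=> h l a b [sh tp lP lF ch] aP bP ab bl tp'.
  have sh' := skew_lower ab sh.
  have bF := ch b bP bl.
  have [e|ne] := eqVneq (F h) (F (lower a b h)).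
    by left; apply: mkS => //; rewrite -e.
  (* As [b] is chosen it cannot enter: either [a] drops out, or [a] is [l], enters, and [b] drops
     out. *)
  case: (lower_changes sh ab ne) => [[_ /setDP[_]]|[/setDP[aF aF'] _]|[/setDP[_ aF] /setDP[_ bF'] _]].
  + by rewrite bF.
  + right; have -> : a == l = false by apply: contraNF lF => /eqP<-.
    exact: mkS.
  + have al : a = l by apply/eqP; apply: contraNT aF; apply: ch.
    by right; rewrite al eqxx -{1}al; apply: mkS.
(* Since [l] is not chosen, [x] beats all other chosen elements. So it is the only one and a
   Condorcet winner, which leaves no room for [l] in [P]. *)
- move=> h l x [sh [[_ dP] minP] lP lF ch] xP xl In.
  have Fx : F h = [set x].
    apply: internal_condorcet => //; first exact: ch.
    move=> v vF vx; have [vP|/(dP _ _ xP)//] := boolP (v \in P).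
    rewrite ltNge; apply: contraNN lF => vx0; rewrite -(In v vP vx) //.
    by rewrite (sh x v); ilia.
  have dx : dominating h [set x].
    split; first by apply/set0Pn; exists x; rewrite inE.
    by move=> a b /set1P->; rewrite inE; apply: chosen_condorcet.
  by have := subsetP (minP _ dx) l lP; rewrite inE eq_sym (negbTE xl).
Qed.

(** * Dominance and robustness of the choice set *)

Lemma undominated_chosen g t : skew g -> (forall D, dominating g D -> t \in D) -> t \in F g.
Proof.
move=> sg all; have [P tP] := top_exists t sg.
by apply: (subsetP (top_chosen sg tP)); apply: all; case: tP.
Qed.

(** The step creates no dominating set, so [a] remains chosen. Every change allowed by
    [lower_changes] needs [a] to leave, or [a] or [b] to enter. *)
Lemma lower_stable g a b : skew g -> a \in F g -> b \in F g -> 0 < g a b ->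
  (forall D, dominating g D -> a \in D) ->
  F (lower a b g) = F g /\ forall D, dominating (lower a b g) D -> dominating g D.
Proof.
move=> sg aF bF gab all.
have ab : a != b by apply: contraTneq gab => ->; rewrite (skew_diag _ sg).
have sub D : dominating (lower a b g) D -> dominating g D by apply: dominating_lower.
split=> //; apply/eqP; rewrite eq_sym; apply: contraT => ne.
have aF' : a \in F (lower a b g).
  by apply: undominated_chosen => [|D /sub/all//]; apply: skew_lower.
by case: (lower_changes sg ab ne) => [[_ /setDP[_]]|[/setDP[_]]|[/setDP[_]]]; rewrite ?aF ?bF ?aF'.
Qed.

Lemma dominating_closed g D x y : skew g -> dominating g D -> x \in D -> 0 <= g y x -> y \in D.
Proof.
move=> sg [_ d] xD yx; apply: contraT => /(d _ _ xD); rewrite (sg y x); ilia.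
Qed.

Lemma chosen_dominating g : skew g -> dominating g (F g).
Proof.
move=> sg; split=> [|x y xF yF]; first exact: F_ne.
rewrite ltNge; apply/negP => gxy.
have [N N0 gN] := bounded (fun x y => - g x y).
set Z := F g in xF yF; pose C := y |: Z.
pose g1 := raise C (~: C) N.+1 g.
have s1 : skew g1 by apply: skew_raise.
have F1 : F g1 = Z.
  apply: raise_free => //; first by rewrite disjoints_subset.
    exact: subsetUr.
  by rewrite disjoints_subset setCS subsetUr.
have g1xy : g1 x y <= 0.
  by rewrite /g1 /raise !inE xF eqxx !orbT /=; move: gxy; clear; ilia.
have [P tP] := top_exists x s1.
have PZ : P \subset Z by rewrite -F1; apply: top_chosen.
have [[/set0Pn[t tP'] _] minP] := tP.
have tZ := subsetP PZ t tP'.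
have all D : dominating g1 D -> t \in D by move=> /minP/subsetP/(_ t tP').
have ty : t != y by apply: contraNneq yF => <-.
have xy : x != y by apply: contraNneq yF => <-.
move: (ltnSn (pos (g1 t x))); move: {2}_.+1 => n.
move: g1 s1 F1 g1xy all {tP PZ minP tP'} => g1; elim: n g1 => // n IHn g1 s1 F1 g1xy all lt.
have [gtx|gtx] := boolP (0 < g1 t x); last first.
  (* Now [x] weakly beats [t] and [y] weakly beats [x], so [y] follows [t] into every dominating
     set. *)
  suff : y \in F g1 by rewrite F1 (negbTE yF).
  apply: undominated_chosen => // D dD.
  apply: (dominating_closed s1 dD (x := x)); last by rewrite (s1 x y); ilia.
  by apply: (dominating_closed s1 dD (all D dD)); rewrite (s1 t x); ilia.
have tx : t != x by apply: contraTneq gtx => ->; rewrite (skew_diag _ s1).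
have [||F2 d2] := @lower_stable g1 t x s1 _ _ gtx all; rewrite ?F1 //.
apply: (IHn (lower t x g1)).
- exact: skew_lower.
- by rewrite F2.
- by rewrite lower_id // ?(eq_sym x) ?(negbTE tx) // andbC (eq_sym y) (negbTE ty).
- by move=> D /d2/all.
- by rewrite -ltnS (leq_trans _ lt) // ltnS lower_lt pos_lt //; ilia.
Qed.

(** Two walks. The first erases the wins inside [X] of an element [t] of the smallest dominating
    set. Then all of [X] weakly beats [t] and lies in every dominating set, so [lower_stable] covers
    the remaining wins inside [X]. *)
Lemma flatten_inside g X : skew g -> dominating g X -> X \subset F g ->
  F (fun x y => if (x \in X) && (y \in X) then 0 else g x y) = F g.
Proof.
move=> sg dX XF; have /set0Pn[x0 _] := dX.1.
have [P tP] := top_exists x0 sg.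
have [[/set0Pn[t tP'] _] minP] := tP.
have tX : t \in X by apply: (subsetP (minP _ dX)).
have all D : dominating g D -> t \in D by move=> /minP/subsetP/(_ t tP').
pose g1 u v := if (u == t) && (v \in X) then Num.min (g u v) 0
  else if (v == t) && (u \in X) then Num.max (g u v) 0 else g u v.
have s1 : skew g1.
  move=> u v; rewrite /g1 (sg u v).
  case: (u =P t) => [->|_]; case: (v =P t) => [->|_] //=; rewrite ?(skew_diag _ sg) ?tX //.
    by case: (v \in X) => //; ilia.
  by case: (u \in X) => //; ilia.
pose I1 h := F h = F g /\ forall D, dominating h D -> t \in D.
have dext h h' : h =2 h' -> forall D, dominating h' D -> dominating h D.
  by move=> e D [D0 d]; split=> // u v uD vD; rewrite e d.
have [F1 all1] : I1 g1.
  apply: (walk (I := I1) _ sg s1) => //.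
    by move=> h h' e [H1 H2]; split; [rewrite -H1; apply/esym/F_ext | move=> D /(dext _ _ e)/H2].
  move=> h a b sh [Fh allh] btw ab lt.
  have [at_ bX hab] : [/\ a = t, b \in X & 0 < h a b].
    move: (btw a b) lt; rewrite /g1 /between; case: (a =P t) => [->|_] /=.
      have [bX|bX] := boolP (b \in X); first by move=> h1 h2; split=> //; move: h1 h2; ilia.
      have -> : b == t = false by apply: contraNF bX => /eqP->.
      by rewrite /=; ilia.
    by case: ifP => _; ilia.
  have aX : a \in X by rewrite at_.
  have [|||F2 d2] := @lower_stable h a b sh _ _ hab; rewrite ?Fh ?(subsetP XF) //.
    by rewrite at_.
  by split=> [|D /d2/allh//]; rewrite F2.
set g0 := fun x y => _.
have s0 : skew g0 by move=> x y; rewrite /g0 andbC (sg x y); case: ifP; ilia.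
have out x y : ~~ ((x \in X) && (y \in X)) -> g1 x y = g0 x y.
  rewrite /g1 /g0 => /negbTE h; rewrite h.
  case: (x =P t) h => [->|_]; first by rewrite tX /= => h; rewrite h; case: (y =P t) h => // ->; rewrite tX.
  by case: (y =P t) => // -> /=; rewrite tX andbT => ->.
pose I2 h := F h = F g /\ forall D, dominating h D -> X \subset D.
suff [] : I2 g0 by [].
apply: (walk (I := I2) _ s1 s0).
- by move=> h h' e [H1 H2]; split; [rewrite -H1; apply/esym/F_ext | move=> D /(dext _ _ e)/H2].
- split=> // D dD; apply/subsetP => x xX.
  have [->|xt] := eqVneq x t; first exact: all1.
  apply: (dominating_closed s1 dD (all1 D dD)).
  by rewrite /g1 (negbTE xt) eqxx xX /=; ilia.
- move=> h a b sh [Fh allh] btw ab lt.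
  have [/andP[aX bX]|nX] := boolP ((a \in X) && (b \in X)); last first.
    by have := btw a b; move: lt; rewrite (out _ _ nX) /between; ilia.
  have hab : 0 < h a b by move: lt; rewrite /g0 aX bX.
  have [|||F2 d2] := @lower_stable h a b sh _ _ hab; rewrite ?Fh ?(subsetP XF) //.
    by move=> D /allh/subsetP; apply.
  by split=> [|D /d2/allh//]; rewrite F2.
Qed.

Lemma chosen_robust g g' : skew g -> skew g' -> dominating g' (F g) -> F g' \subset F g.
Proof.
move=> sg sg' dX; set X := F g in dX *.
case/orP: (dominating_nested sg' dX (chosen_dominating sg')) => // XZ.
pose flat h (x y : A) : int := if (x \in X) && (y \in X) then 0 else h x y.
have sf h : skew h -> skew (flat h).
  by move=> sh x y; rewrite /flat andbC (sh x y); case: ifP; ilia.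
have F0 : F (flat g) = X by apply: flatten_inside => //; apply: chosen_dominating.
have F0' : F (flat g') = F g' by apply: flatten_inside.
have [N N0 gN] := bounded (flat g).
rewrite -F0' -(F_hom (sf _ sg') N0).
have s' : skew (fun x y => flat g' x y * N%:Z).
  by move=> x y /=; rewrite (sf _ sg' x y); ilia.
rewrite (@walk _ (fun h => F h = X) _ _ _ (sf _ sg) s' F0) //.
  by move=> h h' /F_ext <-.
(* Rows of [X] are never lowered: inside [X] both ends are 0, and outside the target is at least
   [N], which bounds the start. *)
move=> h a b sh Fh btw ab lt.
have aX : a \notin X.
  apply: contraTN lt => aX; have := btw a b; have := gN a b.
  rewrite /flat aX /between; have [bX|bX] := boolP (b \in X) => /=; first by ilia.
  by have := dX.2 a b aX bX; move: N0; clear; nia.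
apply/eqP; rewrite -Fh eq_sym; apply: contraT => ne.
case: (lower_changes sh ab ne); rewrite Fh.
- by case; rewrite inE (negbTE aX).
- by case; rewrite !inE (negbTE aX) andbF.
(* The new choice set dominates too, so [a] would beat [b] after being lowered although [b] beat [a]
   before. *)
- case=> /setDP[aF _] /setDP[bX bF] _.
  have [_ /(_ a b aF bF)] := chosen_dominating (skew_lower ab sh).
  have [_] := chosen_dominating sh; rewrite Fh => /(_ b a bX aX).
  by rewrite lower_lt (sh a b); ilia.
Qed.

End Rule.

(** * Profiles with prescribed margins *)

Section Profiles.
Variable A : finType.
Implicit Types (R : profile A) (g : A -> A -> int) (r q : rel A) (x y a b : A).

Lemma marginE R x y :
  margin R x y = \sum_(i <- elect R) ((pref R i x y)%:Z - (pref R i y x)%:Z).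
Proof. by rewrite /margin sumrB !(big_morph Posz PoszD (erefl 0%:Z)). Qed.

Lemma skew_margin R : skew (margin R).
Proof. by move=> x y; rewrite /margin opprB. Qed.

Lemma maj_strictE R x y : maj_strict R x y = (0 < margin R x y).
Proof.
rewrite /maj_strict /maj_weak (skew_margin R x y); move: (margin R x y) => m; clear; lia.
Qed.

Lemma dominantE R (X : {set A}) : dominant R X <-> dominating (margin R) X.
Proof.
by split=> -[X0 d]; split=> // x y xX yX; [rewrite -maj_strictE | rewrite maj_strictE]; apply: d.
Qed.

Lemma total_opp r x y : strict_total_order r -> r x y = (x != y) && ~~ r y x.
Proof.
case=> irr tr tot; have [->|xy] := eqVneq x y; first by rewrite irr.
have := tot x y xy; case rxy : (r x y); case ryx : (r y x) => //= _.
by have := tr _ _ _ rxy ryx; rewrite irr.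
Qed.

Lemma strict_total_rev r : strict_total_order r -> strict_total_order (fun x y => r y x).
Proof.
case=> irr tr tot; split=> // [y x z yx zy|x y xy]; first exact: tr zy yx.
by rewrite orbC tot.
Qed.

Definition order0 : rel A := key_order (fun=> 0%N).

Definition voters r q (s : seq (A -> nat)) : seq (rel A) :=
  [:: r, q & [seq key_order k | k <- s]].

Lemma voters_total r q s i : strict_total_order r -> strict_total_order q ->
  strict_total_order (nth order0 (voters r q s) i).
Proof.
move=> hr hq; case: i => [//|[//|i]] /=.
have [lt|ge] := ltnP i (size s); last first.
  by rewrite nth_default ?size_map //; apply: key_order_total.
by rewrite (nth_map (fun=> 0%N)) //; apply: key_order_total.
Qed.

(** Voters are numbered from 1, hence the predecessor. Voter 1 holds [r] and is the one who will
    manipulate; voter 2 can cancel it by holding the reverse. *)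
Definition profile_of r q (hr : strict_total_order r) (hq : strict_total_order q)
  (s : seq (A -> nat)) : profile A.
Proof.
refine (@Profile A [fset j | j in iota 1 (size s).+2]%fset
  (fun i => nth order0 (voters r q s) i.-1) _ _ _).
- by apply/fset0Pn; exists 1%N; rewrite inE.
- by move=> i; rewrite in_fset -[in_mem _ _]/(i \in iota 1 _) mem_iota; case/andP.
- by move=> i _; apply: voters_total.
Defined.

Definition weight (s : seq (A -> nat)) x y : int :=
  \sum_(k <- s) ((key_order k x y)%:Z - (key_order k y x)%:Z).

Lemma margin_profile_of r q hr hq s x y :
  margin (@profile_of r q hr hq s) x y =
  (r x y)%:Z - (r y x)%:Z + ((q x y)%:Z - (q y x)%:Z) + weight s x y.
Proof.
rewrite marginE /= (perm_big (iota 1 (size s).+2)); last first.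
  by apply: uniq_perm; [apply: fset_uniq | apply: iota_uniq | move=> i; rewrite !inE].
rewrite /= !big_cons addrA; congr (_ + _).
rewrite -[3%N]/(3 + 0)%N iotaDl big_map /weight -(big_map (@key_order A) xpredT
  (fun r : rel A => (r x y)%:Z - (r y x)%:Z)).
by rewrite (big_nth order0) size_map /index_iota subn0; apply: eq_bigr.
Qed.

(** McGarvey's pair, with [key_back]: one voter has [a], [b] on top, the other has them in the same
    order at the bottom with the rest reversed. All but [a] over [b] cancels. *)
Definition key_front a b x : nat := if x == a then 0 else if x == b then 1 else 2.

Definition key_back a b x : nat :=
  if x == a then #|A|.+1 else if x == b then #|A|.+2 else (#|A| - enum_rank x)%N.

Lemma weight_pair a b x y : a != b -> weight [:: key_front a b; key_back a b] x y =
  (((x, y) == (a, b))%:Z - ((x, y) == (b, a))%:Z) * 2.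
Proof.
move=> /eqP ab; rewrite /weight !big_cons big_nil addr0 !xpair_eqE.
have ex (z : A) : (enum_rank z < #|A|)%N by exact: ltn_ord.
move: (ex x) (ex y); rewrite /key_order /key_front /key_back.
case: (x =P a) => xa; case: (y =P b) => yb; case: (x =P b) => xb; case: (y =P a) => ya /=;
  try congruence; try (by clear; lia).
all: by have -> : x = y; [congruence | rewrite !subrr mul0r].
Qed.

Definition mcgarvey g : seq (A -> nat) :=
  flatten [seq flatten (nseq (pos (g p.1 p.2)) [:: key_front p.1 p.2; key_back p.1 p.2])
          | p <- enum [set: A * A]].

Lemma sum_delta (I : finType) (c : I) (h : I -> int) :
  \sum_p (p == c)%:Z * h p = h c.
Proof.
rewrite (bigD1 c) //= eqxx mul1r big1 ?addr0 // => p /negbTE->.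
by rewrite mul0r.
Qed.

Lemma weight_mcgarvey g x y : skew g -> weight (mcgarvey g) x y = g x y * 2.
Proof.
move=> sg; rewrite /weight big_flatten big_map.
transitivity (\sum_p ((p == (x, y))%:Z * (pos (g p.1 p.2))%:Z
                      - (p == (y, x))%:Z * (pos (g p.1 p.2))%:Z) * 2).
  rewrite big_enum /= (eq_bigl xpredT) => [|p]; last by rewrite inE.
  apply: eq_bigr => -[a b] _ /=; have [->|ab] := eqVneq a b.
    by rewrite (skew_diag _ sg) /= big_nil !mulr0 subrr mul0r.
  elim: (pos _) => [|n IHn] /=; first by rewrite big_nil !mulr0 subrr mul0r.
  rewrite 2!big_cons IHn addrA.
  have := weight_pair x y ab; rewrite /weight !big_cons big_nil addr0 => ->.
  have -> : ((x, y) == (b, a)) = ((a, b) == (y, x)) by rewrite !xpair_eqE andbC !(eq_sym a) (eq_sym b).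
  by rewrite (eq_sym (x, y)); case: (_ == _); case: (_ == _); clear; lia.
rewrite -big_distrl /= sumrB !sum_delta /= (sg x y); congr (_ * _).
by case: (g x y) => -[|n] //=; clear; lia.
Qed.

Lemma margin_mcgarvey r q hr hq g x y : (forall x y, q x y = r y x) -> skew g ->
  margin (@profile_of r q hr hq (mcgarvey g)) x y = g x y * 2.
Proof.
move=> qr sg; rewrite margin_profile_of weight_mcgarvey // !qr; clear.
by case: (r x y); case: (r y x); lia.
Qed.

Lemma margin_copies k R x y : (0 < k)%N -> margin (copies k R) x y = margin R x y * k%:Z.
Proof.
case: k => // k _; rewrite !marginE /= (perm_big [seq (i * k.+1 - c)%N | i <- elect R, c <- iota 0 k.+1]).
  rewrite big_allpairs_dep /= mulr_suml !big_seq; apply: eq_bigr => i iR.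
  rewrite -[0%N :: _]/(iota 0 k.+1) (eq_big_seq (fun=> (pref R i x y)%:Z - (pref R i y x)%:Z)).
    by rewrite big_const_seq count_predT size_iota iter_addr_0 -mulr_natr natz.
  by move=> c; rewrite mem_iota => /andP[_ ck] /=; rewrite copies_index // (elect_pos iR).
apply: uniq_perm; first exact: fset_uniq.
  apply: allpairs_uniq => [||[i c] [i' c']]; [exact: fset_uniq | exact: iota_uniq | ].
  case/allpairsPdep=> j [d [jR dk [-> ->]]].
  case/allpairsPdep=> j' [d' [j'R d'k [-> ->]]] /= e.
  have {}dk : (d < k.+1)%N by move: dk; rewrite mem_iota => /andP[].
  have {}d'k : (d' < k.+1)%N by move: d'k; rewrite mem_iota => /andP[].
  have jj : j = j'.
    rewrite -(copies_index (ltn0Sn k) (elect_pos jR) dk) e.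
    exact: copies_index (ltn0Sn k) (elect_pos j'R) d'k.
  congr (_, _) => //; move: e; rewrite jj; have := elect_pos j'R; move: dk d'k; clear.
  by case: j' => // j' dk d'k _; rewrite mulSn; lia.
by move=> j; rewrite in_fset.
Qed.

(** In [R] voter [i] already contributes the least possible to [x] against [y]. *)
Lemma margin_switch R R' i x y : elect R = elect R' -> i \in elect R ->
  (forall j x y, j \in elect R -> j != i -> pref R j x y = pref R' j x y) ->
  pref R i y x -> margin R x y <= margin R' x y.
Proof.
move=> eR iR same yx; rewrite !marginE -eR.
rewrite big_seq [X in _ <= X]big_seq; apply: ler_sum => j jR.
have [->|ji] := eqVneq j i; last by rewrite !(same j).
rewrite yx (total_opp x y (pref_ok iR)) yx andbF; clear.
by case: (pref R' i x y); case: (pref R' i y x).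
Qed.

End Profiles.

(** * From the correspondence [f] to a rule on matrices *)

Section Transfer.
Variables (A : finType) (f : SCC A).
Hypotheses (f_ne : is_SCC f) (f_pw : pairwise_scc f) (f_imp : non_imposing f)
  (f_hom : homogeneous f) (f_neut : neutral f).

Let total0 := key_order_total (fun _ : A => 0%N).

Definition rule_of (g : A -> A -> int) : {set A} :=
  f (profile_of total0 (strict_total_rev total0) (mcgarvey g)).

Let margin_of g x y : skew g ->
  margin (profile_of total0 (strict_total_rev total0) (mcgarvey g)) x y = g x y * 2.
Proof. exact: margin_mcgarvey. Qed.

Lemma rule_ofE g R : skew g -> (forall x y, margin R x y = g x y * 2) -> f R = rule_of g.
Proof. by move=> sg e; apply: f_pw => x y; rewrite e margin_of. Qed.

(** Two copies of [R] absorb the factor 2 of McGarvey's construction. *)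
Lemma rule_of_margin R : f R = rule_of (margin R).
Proof.
rewrite -(f_hom R (isT : 1 <= 2)%N); apply: rule_ofE; first exact: skew_margin.
by move=> x y; rewrite margin_copies.
Qed.

Lemma rule_of_ext g g' : g =2 g' -> rule_of g = rule_of g'.
Proof.
move=> e; rewrite /rule_of; congr (f (profile_of _ _ _)); rewrite /mcgarvey.
by congr flatten; apply: eq_map => p; rewrite e.
Qed.

Lemma rule_of_ne g : skew g -> rule_of g != set0.
Proof. by move=> _; apply: f_ne. Qed.

Lemma rule_of_hom g N : skew g -> (0 < N)%N -> rule_of (fun x y => g x y * N%:Z) = rule_of g.
Proof.
move=> sg N0; rewrite {2}/rule_of -(f_hom _ N0); apply/esym/rule_ofE.
  by move=> x y; rewrite (sg x y) mulNr.
by move=> x y; rewrite margin_copies // margin_of // mulrAC.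
Qed.

Lemma rule_of_neutral g g' (pi : {perm A}) : skew g -> skew g' ->
  (forall x y, g x y = g' (pi x) (pi y)) -> rule_of g' = pi @: rule_of g.
Proof.
move=> sg sg' e; set R := profile_of total0 (strict_total_rev total0) (mcgarvey g).
have ok i : i \in elect R ->
    strict_total_order (fun x y => pref R i ((pi^-1)%g x) ((pi^-1)%g y)).
  move=> /(@pref_ok _ R)[irr tr tot]; split=> [x|y x z|x y xy]; first exact: irr.
    exact: tr.
  by apply: tot; rewrite (inj_eq perm_inj).
pose R' := Profile (elect_ne R) (@elect_pos _ R) ok.
have -> : rule_of g' = f R'.
  apply/esym/rule_ofE => // x y.
  by rewrite -(permKV pi x) -(permKV pi y) -e -margin_of // !marginE /= !permK.
by apply: f_neut => // i x y _; rewrite /= !permK.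
Qed.

Lemma rule_of_imp x : exists2 g, skew g & rule_of g = [set x].
Proof.
by have [R fR] := f_imp x; exists (margin R); [apply: skew_margin | rewrite -rule_of_margin].
Qed.

(** Voter 1 holds [r] and voter 2 its reverse; when voter 1 switches to [r'], the margins change by
    twice the difference of the two relations. *)
Lemma rule_of_sp g r r' : strategyproof f -> skew g ->
  strict_total_order r -> strict_total_order r' ->
  ~ fishburn r (rule_of (fun x y => g x y + (r' x y)%:Z - (r x y)%:Z)) (rule_of g).
Proof.
move=> sp sg hr hr' fb; apply: sp.
have skd : skew (fun x y => g x y + (r' x y)%:Z - (r x y)%:Z).
  move=> x y; rewrite (sg x y); have [->|xy] := eqVneq x y.
    by rewrite (skew_diag _ sg) oppr0 (total_opp _ _ hr) (total_opp _ _ hr') eqxx.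
  rewrite (total_opp y x hr) (total_opp y x hr') eq_sym xy /=.
  by case: (r x y); case: (r' x y); clear; lia.
pose R := profile_of hr (strict_total_rev hr) (mcgarvey g).
pose R' := profile_of hr' (strict_total_rev hr) (mcgarvey g).
exists R, R', 1%N; split=> //; first by rewrite inE.
  by move=> j x y /(@elect_pos _ R); case: j => [|[|j]].
have -> : f R = rule_of g by apply: rule_ofE => // x y; apply: margin_mcgarvey.
have -> : f R' = rule_of (fun x y => g x y + (r' x y)%:Z - (r x y)%:Z).
  apply: rule_ofE => // x y; rewrite margin_profile_of weight_mcgarvey //.
  have [->|xy] := eqVneq x y.
    by rewrite !subrr (skew_diag _ sg) (total_opp _ _ hr) (total_opp _ _ hr') eqxx.
  rewrite (total_opp y x hr) (total_opp y x hr') eq_sym xy /=.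
  by case: (r x y); case: (r' x y); clear; lia.
exact: fb.
Qed.

End Transfer.

Theorem theorem1 (A : finType) (f : SCC A) :
  is_SCC f -> pairwise_scc f -> non_imposing f -> homogeneous f -> neutral f ->
  (strategyproof f <-> dominant_set_rule f /\ robust f).
Proof.
move=> f_ne f_pw f_imp f_hom f_neut; split=> [sp|[dom rob]].
  have ext := @rule_of_ext A f; have ne := rule_of_ne f_ne.
  have hom := rule_of_hom f_pw f_hom; have neut := rule_of_neutral f_pw f_neut.
  have imp := rule_of_imp f_pw f_imp f_hom.
  have sp' g r r' := @rule_of_sp A f f_pw g r r' sp.
  split=> [R|R R'].
    apply/dominantE; rewrite (rule_of_margin f_pw f_hom).
    by apply: chosen_dominating => //; apply: skew_margin.
  move/dominantE; rewrite !(rule_of_margin f_pw f_hom).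
  by apply: chosen_robust => //; apply: skew_margin.
case=> R [R' [i [eR iR same [ne [lo hi]]]]].
have sw x y := @margin_switch _ R R' i x y eR iR same.
have [/dominantE[X0 dX] /dominantE[Y0 dY]] := (dom R, dom R').
set X := f R in ne lo hi X0 dX *; set Y := f R' in ne lo hi Y0 dY *.
have [YX|/subsetPn[y yY yX]] := boolP (Y \subset X).
  (* Voter [i] ranks [Y] above [X :\: Y] in [R], so the switch could not help [Y] there: [Y] was
     dominant already, and robustness forces [X] into [Y]. *)
  have dR : dominant R Y.
    apply/dominantE; split=> // y v yY vY.
    have [vX|vX] := boolP (v \in X); last by apply: dX (subsetP YX _ yY) vX.
    have := dY y v yY vY; rewrite (skew_margin R v y) (skew_margin R' v y) !oppr_gt0.
    by apply: le_lt_trans; apply: sw; apply: hi; rewrite ?inE ?vX ?vY.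
  by move: ne; rewrite eqEsubset YX (rob R' R dR).
have [XY|/subsetPn[x xX xY]] := boolP (X \subset Y).
  have dR : dominant R' X.
    apply/dominantE; split=> // x v xX vX.
    have [vY|vY] := boolP (v \in Y); last by apply: dY (subsetP XY _ xX) vY.
    apply: lt_le_trans (dX x v xX vX) _.
    by apply: sw; apply: lo; rewrite ?inE ?vX ?vY.
  by move: ne; rewrite eqEsubset XY (rob R R' dR).
(* [x] beats [y] in [R], and a voter with [y] above [x] cannot reverse this, against the dominance
   of [Y] in [R']. *)
have yx : pref R i y x by apply: lo; rewrite ?inE ?yX ?yY.
have := le_trans (ltW (dX x y xX yX)) (sw x y yx); rewrite (skew_margin R' y x).
by rewrite oppr_ge0 leNgt dY.
Qed.
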